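(* Let $\mathcal{E}$ and $\widehat{\mathcal{E}}$ be two Markovian homogeneous convex expectations on $\mathrm{USA}_b(\Omega;\mathbb{R})$ without fixed times of discontinuity, and denote by $(T_t)_{t\ge0}$ and $(\widehat{T}_t)_{t\ge0}$ the associated Markovian semigroups. Furthermore, assume that $\widehat{\mathcal{E}}$ is continuity preserving. Then the following are equivalent: (i) $T_t\le\widehat{T}_t$ on $C_b(E;\mathbb{R})$ for all $t>0$. (ii) $\mathcal{E}\le\widehat{\mathcal{E}}$ on $\mathrm{USA}_b(\Omega;\mathbb{R})$, i.e. $\mathcal{E}_t(\varphi)(\omega)\le\widehat{\mathcal{E}}_t(\varphi)(\omega)$ for all $(t,\omega)\in\mathbb{R}\times\Omega$ and $\varphi\in\mathrm{USA}_b(\Omega;\mathbb{R})$.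
   Context: Path space. Let $E$ be a Polish space and let $\Omega$ be either the space $D(\mathbb{R};E)$ of all càdlàg functions $\mathbb{R}\to E$ or the space $C(\mathbb{R};E)$ of all continuous functions, endowed with the two-sided Skorokhod $J_1$ topology (the local uniform topology if $\Omega=C(\mathbb{R};E)$). $X_t(\omega)=\omega(t)$, $t\in\mathbb{R}$, is the coordinate process; $\{\Delta X_s\neq0\}$ denotes $\{X_s\neq X_{s-}\}$. $\mathcal{F}=\sigma(X_t,t\in\mathbb{R})$ (the Borel $\sigma$-field of $\Omega$), $\mathcal{F}_t=\sigma(X_s,s\le t)$, $\theta_t(\omega)=\omega(\cdot+t)$. For a $\sigma$-field $\mathcal{G}$, a set is $\mathcal{G}$-analytic if it has the form $\bigcup_{(n_i)\in\mathbb{N}^\infty}\bigcap_{k\in\mathbb{N}}A_{n_1,\dots,n_k}$ with all $A_{n_1,\dots,n_k}\in\mathcal{G}$; a function $f$ is upper $\mathcal{G}$-semianalytic if $\{f\ge c\}$ is $\mathcal{G}$-analytic for all $c\in\mathbb{R}$. $\mathrm{USA}_b(\Omega,\mathcal{G};\mathbb{R})$ is the set of bounded upper $\mathcal{G}$-semianalytic functions $\Omega\to\mathbb{R}$, $\mathrm{USA}_b(\Omega;\mathbb{R})=\mathrm{USA}_b(\Omega,\mathcal{F};\mathbb{R})$, and $\mathrm{USA}_b(\mathbb{R}\times\Omega;\mathbb{R})$ is defined analogously with $\mathcal{B}(\mathbb{R})\otimes\mathcal{F}$. $C_b$: bounded continuous functions. Convex expectation. A convex expectation on $\mathrm{USA}_b(\Omega;\mathbb{R})$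 is a map $\mathcal{E}:\mathrm{USA}_b(\Omega;\mathbb{R})\to\mathrm{USA}_b(\mathbb{R}\times\Omega;\mathbb{R})$, written $\mathcal{E}(\varphi)(t,\omega)=\mathcal{E}_t(\varphi)(\omega)$, such that: (E1) $\mathcal{E}_t(\varphi)\in\mathrm{USA}_b(\Omega,\mathcal{F}_t;\mathbb{R})$ for all $t\in\mathbb{R}$, $\varphi\in\mathrm{USA}_b(\Omega;\mathbb{R})$; (E2) $\mathcal{E}_t(\varphi)=\varphi$ for all $t$ and $\varphi\in\mathrm{USA}_b(\Omega,\mathcal{F}_t;\mathbb{R})$; (E3) $\mathcal{E}_t(\varphi)\le\mathcal{E}_t(\psi)$ whenever $\varphi\le\psi$; (E4) $\mathcal{E}_t(\lambda\varphi+(1-\lambda)\psi)\le\lambda\mathcal{E}_t(\varphi)+(1-\lambda)\mathcal{E}_t(\psi)$ for $\lambda\in(0,1)$; (E5) $\omega\mapsto\mathcal{E}_t(\varphi)(\omega)$ is $\mathcal{F}_t$-measurable for all $t$ and $\varphi\in C_b(\Omega;\mathbb{R})$; (E6) $\mathcal{E}_t(\mathcal{E}_s(\varphi))=\mathcal{E}_t(\varphi)$ for all $s>t$ and $\varphi\in\mathrm{USA}_b(\Omega;\mathbb{R})$; (E7) for every $t$: $\mathcal{E}_t(\varphi_n)\searrow\mathcal{E}_t(\varphi)$ for all $(\varphi_n)\subset C_b(\Omega;\mathbb{R})$ with $\varphi_n\searrow\varphi\in\mathrm{USA}_b(\Omega;\mathbb{R})$, and $\mathcal{E}_t(\varphi_n)\nearrow\mathcal{E}_t(\varphi)$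 for all $(\varphi_n)\subset\mathrm{USA}_b(\Omega;\mathbb{R})$ with $\varphi_n\nearrow\varphi\in\mathrm{USA}_b(\Omega;\mathbb{R})$. It has no fixed times of discontinuity if $\mathcal{E}_t(a\mathbf{1}_{\{\Delta X_s\ne0\}})(\omega)=0$ for all $t\in\mathbb{R}$, $\omega\in\Omega$, $s>t$, $a>0$. It is homogeneous if $\mathcal{E}_t(\varphi)=\mathcal{E}_0(\varphi\circ\theta_{-t})\circ\theta_t$ for all $t\in\mathbb{R}$, $\varphi\in\mathrm{USA}_b(\Omega;\mathbb{R})$. Markovian structure. A homogeneous convex expectation $\mathcal{E}$ is Markovian if, for all $g\in C_b(E;\mathbb{R})$ and $t>0$, $\mathcal{E}_0(g(X_t))(\omega)$ depends on $\omega$ only through $\omega(0)$. Its associated Markovian semigroup is $T_t(g)(x)=\mathcal{E}_0(g(X_t))(\omega)|_{\omega(0)=x}$, $t\in\mathbb{R}_+$, $g\in C_b(E;\mathbb{R})$, $x\in E$. It is continuity preserving if $(x_1,\dots,x_n)\mapsto T_t(g(x_1,\dots,x_n,\cdot\,))(x_n)$ is an element of $C_b(E^n;\mathbb{R})$ for all $g\in C_b(E^{n+1};\mathbb{R})$, $t>0$, $n\in\mathbb{N}$. *)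

(* Defs.v *)
From HB Require Import structures.
From mathcomp Require Import all_boot all_order all_algebra.
From mathcomp Require Import all_classical all_reals all_analysis.

Set Implicit Arguments.
Unset Strict Implicit.
Unset Printing Implicit Defensive.

Import Order.TTheory GRing.Theory Num.Theory.
Import numFieldTopology.Exports numFieldNormedType.Exports.

Local Open Scope classical_set_scope.
Local Open Scope ring_scope.

Section set_systems.
Context {R : realType} {X : Type}.
Implicit Types (G : set_system X) (f g : X -> R).

(* The Souslin scheme is indexed by the non-empty finite sequences
   (n_1, ..., n_k). *)
Definition analytic_set G (S : set X) : Prop :=
  exists A : seq nat -> set X,
    (forall s, G (A s)) /\
    S = \bigcup_(n in [set: nat -> nat]) \bigcap_(k in [set: nat])
          A (mkseq n k.+1).

Definition bounded_real f : Prop := exists M, forall x, `|f x| <= M.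

Definition upper_semianalytic G f : Prop :=
  forall c : R, analytic_set G [set x | c <= f x].

Definition USAb G f : Prop := bounded_real f /\ upper_semianalytic G f.

Definition measurable_wrt G f : Prop :=
  forall B : set R, measurable B -> G (f @^-1` B).

Definition decreases_to (u : nat -> X -> R) f : Prop :=
  (forall x, nonincreasing_seq (u ^~ x)) /\
  (forall x, u n x @[n --> \oo] --> f x).

Definition increases_to (u : nat -> X -> R) f : Prop :=
  (forall x, nondecreasing_seq (u ^~ x)) /\
  (forall x, u n x @[n --> \oo] --> f x).

End set_systems.

Definition borel (T : topologicalType) : set_system T := <<s @open T >>.

Definition Cb {R : realType} {T : topologicalType} (f : T -> R) : Prop :=
  bounded_real f /\ continuous f.

(* A Polish space is presented by a separable complete compatible metric. *)
Definition separable_complete {R : realType} (E : metricType R) : Prop :=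
  (exists2 D : set E, countable D & dense D) /\
  (forall F : set_system E, ProperFilter F -> cauchy F ->
    exists x : E, F --> x).

Variant path_kind := CadlagPaths | ContinuousPaths.

Section path_space.
Context {R : realType} {E : metricType R}.

Definition cadlag (w : R -> E) : Prop :=
  forall t, w s @[s --> t^'+] --> w t /\
    exists l : E, w s @[s --> t^'-] --> l.

Definition is_path (k : path_kind) (w : R -> E) : Prop :=
  match k with CadlagPaths => cadlag w | ContinuousPaths => continuous w end.

Record pathT (k : path_kind) :=
  Path { path_fun :> R -> E ; path_funP : is_path k path_fun }.

HB.instance Definition _ k := gen_eqMixin (pathT k).
HB.instance Definition _ k := gen_choiceMixin (pathT k).

(* Increasing bijections of the line are automatically homeomorphisms. *)
Definition time_change (lam : R -> R) : Prop :=
  {homo lam : s t / s < t} /\ bijective lam.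

(* For cadlag paths, v_n lies eventually in each of these sets iff there are
   time changes lam_n such that lam_n --> id and v_n \o lam_n --> w, both
   uniformly on compacts, i.e. iff v_n --> w in the two-sided J1 topology; as
   the latter is metrizable, these sets form a basis of its neighbourhoods of
   w. For continuous paths they are the basic neighbourhoods of the topology
   of locally uniform convergence. *)
Definition path_nbhs (k : path_kind) (w : pathT k) (N e : R) : set (pathT k) :=
  match k return pathT k -> set (pathT k) with
  | CadlagPaths => fun w => [set v | exists lam, time_change lam /\
      forall t, `|t| <= N -> `|lam t - t| < e /\ ball (w t) e (v (lam t))]
  | ContinuousPaths => fun w => [set v |
      forall t, `|t| <= N -> ball (w t) e (v t)]
  end w.

Definition path_open (k : path_kind) : set_system (pathT k) :=
  [set A | forall w, A w ->
    exists N e : R, 0 < e /\ path_nbhs w N e `<=` A].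

Lemma path_nbhsS k (w : pathT k) N N' e e' : N <= N' -> e' <= e ->
  path_nbhs w N' e' `<=` path_nbhs w N e.
Proof.
move=> NN' ee'; case: k w => w v /=.
  move=> [lam [tl h]]; exists lam; split=> // t tN.
  have [h1 h2] := h t (le_trans tN NN').
  by split; [exact: lt_le_trans h1 ee'|exact: le_ball h2].
by move=> h t tN; apply: le_ball ee' _ _; apply: h; exact: le_trans NN'.
Qed.

Lemma path_openT k : @path_open k setT.
Proof. by move=> w _; exists 0, 1. Qed.

Lemma path_openI k : setI_closed (@path_open k).
Proof.
move=> A B oA oB w [/oA [N [e [e0 hA]]] /oB [N' [e' [e'0 hB]]]].
exists (Num.max N N'), (Num.min e e'); split; first by rewrite lt_min e0.
move=> v hv; split; [apply: hA|apply: hB]; apply: path_nbhsS hv.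
- by rewrite le_max lexx.
- by rewrite ge_min lexx.
- by rewrite le_max lexx orbT.
- by rewrite ge_min lexx orbT.
Qed.

Lemma path_open_bigU k (I : Type) (f : I -> set (pathT k)) :
  (forall i, path_open (f i)) -> path_open (\bigcup_i f i).
Proof.
move=> fo w [i _ /fo [N [e [e0 h]]]]; exists N, e; split=> //.
by move=> v /h ?; exists i.
Qed.

HB.instance Definition _ k := isOpenTopological.Build (pathT k)
  (@path_openT k) (@path_openI k) (@path_open_bigU k).

Lemma cvg_addr_right (a t : R) : (s + a) @[s --> t^'+] --> (t + a)^'+.
Proof.
move=> A [e /= e0 hA]; exists e => //= s sb ts; apply: hA => /=.
  by rewrite opprD addrACA subrr addr0.
by rewrite ltrD2r.
Qed.

Lemma cvg_addr_left (a t : R) : (s + a) @[s --> t^'-] --> (t + a)^'-.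
Proof.
move=> A [e /= e0 hA]; exists e => //= s sb ts; apply: hA => /=.
  by rewrite opprD addrACA subrr addr0.
by rewrite ltrD2r.
Qed.

Lemma shift_is_path k (a : R) (w : R -> E) :
  is_path k w -> is_path k (fun s => w (s + a)).
Proof.
case: k => /= hw t.
  have [hr [l hl]] := hw (t + a); split.
    exact: (cvg_comp _ w (cvg_addr_right (a := a) (t := t)) hr).
  by exists l; exact: (cvg_comp _ w (cvg_addr_left (a := a) (t := t)) hl).
apply: (@continuous_comp _ _ _ (fun s : R => s + a) w); last exact: hw.
by apply: cvgD; [exact: cvg_id|exact: cvg_cst].
Qed.

Lemma cst_is_path k (x : E) : is_path k (fun=> x).
Proof.
case: k => /= t; last exact: cvg_cst.
by split; [|exists x]; exact: cvg_cst.
Qed.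

Definition path_shift k (a : R) (w : pathT k) : pathT k :=
  Path (shift_is_path a (path_funP w)).

Definition cst_path k (x : E) : pathT k := Path (cst_is_path k x).

Definition sF k : set_system (pathT k) :=
  <<s [set A | exists s B, borel B /\ A = [set w : pathT k | B (w s)]] >>.

Definition sFt k (t : R) : set_system (pathT k) :=
  <<s [set A | exists s B,
         [/\ s <= t, borel B & A = [set w : pathT k | B (w s)]]] >>.

Definition sRF k : set_system (R * pathT k) :=
  <<s [set C | exists (B : set R) (A : set (pathT k)),
         [/\ measurable B, sF A & C = B `*` A]] >>.

Definition jump_at k (s : R) : set (pathT k) :=
  [set w | exists2 l : E, w r @[r --> s^'-] --> l & w s <> l].

End path_space.

Arguments pathT {R} E k.
Arguments sF {R} E k.
Arguments sFt {R} E k t.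
Arguments sRF {R} E k.
Arguments jump_at {R} E k s.
Arguments cst_path {R E} k x.

Section convex_expectations.
Context {R : realType} {E : metricType R} {k : path_kind}.
Local Notation Omega := (pathT E k).

(* A map on USA_b(Omega) is represented by a total function whose values
   outside USA_b(Omega) are irrelevant: [calE t phi w] is E_t(phi)(w). *)
Implicit Types calE : R -> (Omega -> R) -> Omega -> R.

Record convex_expectation calE : Prop := ConvexExpectation {
  cexp_usa : forall phi, USAb (sF E k) phi ->
    USAb (sRF E k) (fun p : R * Omega => calE p.1 phi p.2) ;
  cexp_adapted : forall t phi, USAb (sF E k) phi ->
    USAb (sFt E k t) (calE t phi) ;
  cexp_id : forall t phi, USAb (sFt E k t) phi ->
    forall w, calE t phi w = phi w ;
  cexp_mono : forall t phi psi, USAb (sF E k) phi -> USAb (sF E k) psi ->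
    (forall w, phi w <= psi w) -> forall w, calE t phi w <= calE t psi w ;
  cexp_convex : forall t phi psi, USAb (sF E k) phi -> USAb (sF E k) psi ->
    forall lam : R, 0 < lam < 1 -> forall w,
    calE t (fun w' => lam * phi w' + (1 - lam) * psi w') w <=
      lam * calE t phi w + (1 - lam) * calE t psi w ;
  cexp_measurable : forall t (phi : Omega -> R), Cb phi ->
    measurable_wrt (sFt E k t) (calE t phi) ;
  cexp_tower : forall t s phi, t < s -> USAb (sF E k) phi ->
    forall w, calE t (calE s phi) w = calE t phi w ;
  cexp_decr : forall t (u : nat -> Omega -> R) phi,
    (forall n, Cb (u n)) -> USAb (sF E k) phi -> decreases_to u phi ->
    decreases_to (fun n => calE t (u n)) (calE t phi) ;
  cexp_incr : forall t (u : nat -> Omega -> R) phi,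
    (forall n, USAb (sF E k) (u n)) -> USAb (sF E k) phi ->
    increases_to u phi ->
    increases_to (fun n => calE t (u n)) (calE t phi)
}.

Definition no_fixed_discontinuity calE : Prop :=
  forall (t : R) (w : Omega) (s a : R), t < s -> 0 < a ->
    calE t (fun w' => a * \1_(jump_at E k s) w') w = 0.

Definition homogeneous calE : Prop :=
  forall t phi, USAb (sF E k) phi -> forall w,
    calE t phi w = calE 0 (phi \o path_shift (- t)) (path_shift t w).

Definition markovian calE : Prop :=
  forall (g : E -> R) t, Cb g -> 0 < t -> forall w w' : Omega, w 0 = w' 0 ->
    calE 0 (fun v => g (v t)) w = calE 0 (fun v => g (v t)) w'.

(* T_t(g)(x) = E_0(g(X_t))(w) for any w with w(0) = x, read off at the constant
   path; see markov_semigroupE. *)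
Definition markov_semigroup calE (t : R) (g : E -> R) (x : E) : R :=
  calE 0 (fun v : Omega => g (v t)) (cst_path k x).

Lemma markov_semigroupE calE : markovian calE ->
  forall t (g : E -> R), 0 < t -> Cb g -> forall w : Omega,
    markov_semigroup calE t g (w 0) = calE 0 (fun v => g (v t)) w.
Proof. by move=> calEM t g t0 gCb w; exact: calEM. Qed.

(* E^n is 'rV[E]_n with its product topology; the n >= 1 of the definition is
   n.+1 here. *)
Definition continuity_preserving calE : Prop :=
  forall (n : nat) (g : 'rV[E]_(n.+1 + 1) -> R) (t : R), Cb g -> 0 < t ->
    Cb (fun x : 'rV[E]_n.+1 =>
      markov_semigroup calE t (fun y => g (row_mx x (const_mx y)))
        (x ord0 ord_max)).

End convex_expectations.

(* Main.v *)
Require Import Defs.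
From mathcomp Require Import all_boot all_order all_algebra lra ring.
From mathcomp Require Import all_classical all_reals all_analysis.

Set Implicit Arguments.
Unset Strict Implicit.
Unset Printing Implicit Defensive.

Import Order.TTheory GRing.Theory Num.Theory.
Import numFieldTopology.Exports numFieldNormedType.Exports.

Local Open Scope classical_set_scope.
Local Open Scope ring_scope.

(** The semigroup is the expectation of functions of one coordinate, so only the
    passage from the semigroups to the expectations needs an argument. It has
    two halves.

    Cylinder functions. For [f] bounded and continuous and times
    [t_1 < ... < t_m], the expectation of [f (X_{t_1}, ..., X_{t_m})] at time
    [t] is computed from the last coordinate backwards. Given the past,
    all coordinates but the last one are known, so they may be replaced by
    their values on the conditioning path; by homogeneity and the Markov
    property what remains is a value of the semigroup
    ([cexp_last_coordinate]). Hence the inequality of semigroups is an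
    inequality of one-step conditional expectations. Continuity preservation
    says that the larger of the two is again a bounded continuous function of
    the remaining coordinates, and the tower property concludes by induction
    ([path_row_le], [cylinder_le]).

    Capacitability. An expectation at a fixed [(t, w)] behaves like a Choquet
    capacity, so its value at an upper semianalytic function is approached from
    below by its values at decreasing limits of cylinder functions. Precisely
    ([choquet_comparison]), if [C <= D] on a lattice [L] of functions, [C] is
    continuous from below on semianalytic functions, [D] is continuous from
    above along decreasing sequences of [L], and the sigma-field consists of
    Souslin sets over the sets [1 <= u] with [u] in [L], then [C <= D] on all
    bounded semianalytic functions.

    The difficulty in combining the halves is that an expectation is only
    known to be continuous from above along continuous functions, whereas
    cylinder functions are not continuous for the J1 topology. The absence of
    fixed discontinuities repairs this. Evaluation [g (X_s)] at a future time,
    for [g] Lipschitz, is the decreasing limit of the continuous functions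
    [sup_r (g (X_r) - n |r - s|)] at every path that does not jump at [s]
    ([sup_convolution_Cb], [sup_convolution_cvg]); at a past time it is
    constant outside the set of paths that differ from [w] at [s]. Both
    exceptional sets are null, and by convexity null sets do not influence the
    expectation ([cexp_null_le]). So continuity from above extends to the
    lattice of those cylinder functions that are, outside a null set, decreasing
    limits of continuous functions ([approximable_decreasing]), and this
    lattice is rich enough to generate the sigma-field ([sF_sub_analytic]). *)

(** * The Souslin operation *)

Section souslin.
Context {T : Type}.
Implicit Types (P G : set_system T) (A : set T).

Lemma sub_analytic P : P `<=` analytic_set P.
Proof.
move=> A PA; exists (fun=> A); split=> //; apply/seteqP; split=> [x Ax|x].
  by exists (fun=> 0%N).
by move=> [s _ /(_ 0%N)]; exact.
Qed.

Lemma analyticS P Q : P `<=` Q -> analytic_set P `<=` analytic_set Q.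
Proof. by move=> PQ _ [A [PA ->]]; exists A; split=> // s; exact/PQ. Qed.

Lemma eq_mkseq_lt (U : Type) (f g : nat -> U) n :
  (forall i, (i < n)%N -> f i = g i) -> mkseq f n = mkseq g n.
Proof.
by move=> fg; apply/eq_in_map => i; rewrite mem_iota add0n /= => /fg.
Qed.

(** One sequence carrying [s] on the codes [0; i] and [t k] on the codes
    [k + 1; i]; [track] reads these components back. *)
Let interleave (s : nat -> nat) (t : nat -> nat -> nat) (n : nat) : nat :=
  let c := CodeSeq.decode n in
  if nth 0%N c 0%N is k.+1 then t k (nth 0%N c 1%N) else s (nth 0%N c 1%N).

Let track (r : nat -> nat) (a i : nat) : nat := r (CodeSeq.code [:: a; i]).

(** The condition with number (k, j) reads the first [k + 1] entries of track 0
    and the first [j + 1] entries of track [k + 1]; a prefix of length [N]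
    decides it when it contains all of them. *)
Let readable (k j N : nat) : bool :=
  all (fun i => CodeSeq.code [:: 0; i]%N < N)%N (iota 0 k.+1) &&
  all (fun i => CodeSeq.code [:: k.+1; i] < N)%N (iota 0 j.+1).

Let readable_large k j : exists b, forall N, (b <= N)%N -> readable k j N.
Proof.
exists (\max_(i < k.+1) CodeSeq.code [:: 0; nat_of_ord i]%N +
   \max_(i < j.+1) CodeSeq.code [:: k.+1; nat_of_ord i]).+1 => N bN.
apply/andP; split; apply/allP => i; rewrite mem_iota add0n => /= ik.
  apply: leq_trans bN; rewrite ltnS; apply: leq_trans (leq_addr _ _).
  exact: (@leq_bigmax _
    (fun i : 'I_k.+1 => CodeSeq.code [:: 0; nat_of_ord i]%N) (Ordinal ik)).
apply: leq_trans bN; rewrite ltnS; apply: leq_trans (leq_addl _ _).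
exact: (@leq_bigmax _
  (fun i : 'I_j.+1 => CodeSeq.code [:: k.+1; nat_of_ord i]) (Ordinal ik)).
Qed.

(** A branch [s] through the outer scheme together with branches [t k] through
    the inner schemes attached to the prefixes of [s] is coded by the single
    sequence [interleave s t]. A prefix of length [N + 1] tests the condition
    (k, j), where [N] is the code of [k; j; b]; the padding [b] makes each
    condition recur at prefixes long enough to decide it. *)
Theorem analytic_idem P : P setT ->
  analytic_set (analytic_set P) `<=` analytic_set P.
Proof.
move=> PT _ [A [/choice[Z ZA] ->]].
pose B (r : seq nat) : set T :=
  let c := CodeSeq.decode (size r).-1 in
  let k := nth 0%N c 0%N in let j := nth 0%N c 1%N in
  if readable k j (size r) then
    Z (mkseq (track (nth 0%N r) 0%N) k.+1)
      (mkseq (track (nth 0%N r) k.+1) j.+1)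
  else setT.
have BE r N (c := CodeSeq.decode N) (k := nth 0%N c 0%N) (j := nth 0%N c 1%N) :
    B (mkseq r N.+1) = if readable k j N.+1 then
      Z (mkseq (track r 0%N) k.+1) (mkseq (track r k.+1) j.+1) else setT.
  rewrite /B size_mkseq /= -/c -/k -/j; case: ifP => // /andP[rk rj].
  congr Z; apply: eq_mkseq_lt => i ilt; rewrite /track nth_mkseq //.
    by have /allP/(_ i) := rk; apply; rewrite mem_iota.
  by have /allP/(_ i) := rj; apply; rewrite mem_iota.
exists B; split=> [r|].
  by rewrite /B; case: ifP => // _; have [+ _] := ZA (mkseq
    (track (nth 0%N r) 0) (nth 0%N (CodeSeq.decode (size r).-1) 0%N).+1); exact.
apply/seteqP; split=> x.
  move=> [s _ Ax].
  have /choice[t tZ] : forall k, exists t : nat -> nat,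
      forall j, Z (mkseq s k.+1) (mkseq t j.+1) x.
    move=> k; have := Ax k I; have [_ ->] := ZA (mkseq s k.+1).
    by move=> [t _ tx]; exists t => j; exact: tx.
  exists (interleave s t) => // N _ /=; rewrite BE; case: ifP => // _.
  set k := nth 0%N _ 0; set j := nth 0%N _ 1.
  have -> : mkseq (track (interleave s t) 0) k.+1 = mkseq s k.+1.
    by apply: eq_mkseq_lt => i _; rewrite /track /interleave CodeSeq.codeK.
  have -> : mkseq (track (interleave s t) k.+1) j.+1 = mkseq (t k) j.+1.
    by apply: eq_mkseq_lt => i _; rewrite /track /interleave CodeSeq.codeK.
  exact: tZ.
move=> [r _ Bx]; exists (track r 0%N) => // k _ /=.
have [_ ->] := ZA (mkseq (track r 0) k.+1).
exists (track r k.+1) => // j _ /=.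
have [b bP] := readable_large k j.
have := Bx (CodeSeq.code [:: k; j; b]) I; rewrite BE CodeSeq.codeK /=.
rewrite bP //; have /allP/(_ b) := CodeSeq.ltn_code [:: k; j; b].
by rewrite !inE eqxx !orbT => /(_ isT) /ltnW /leqW.
Qed.

Lemma analytic_bigcup P (A : nat -> set T) : P setT ->
  (forall n, analytic_set P (A n)) -> analytic_set P (\bigcup_n A n).
Proof.
move=> PT anA; apply: analytic_idem => //.
exists (fun s => A (head 0%N s)); split=> //.
apply/seteqP; split=> x.
  by move=> [n _ Anx]; exists (fun=> n) => // k _.
by move=> [s _ /(_ 0%N I)] /= ?; exists (s 0%N).
Qed.

Lemma analytic_bigcap P (A : nat -> set T) : P setT ->
  (forall n, analytic_set P (A n)) -> analytic_set P (\bigcap_n A n).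
Proof.
move=> PT anA; apply: analytic_idem => //.
exists (fun s => A (size s).-1); split=> //.
apply/seteqP; split=> x.
  by move=> Ax; exists (fun=> 0%N) => // k _; rewrite size_mkseq; exact: Ax.
by move=> [s _ Ax] k _; have := Ax k I; rewrite size_mkseq.
Qed.

Lemma analyticU P A B : P setT ->
  analytic_set P A -> analytic_set P B -> analytic_set P (A `|` B).
Proof.
move=> PT anA anB; rewrite [_ `|` _](_ : _ =
    \bigcup_n (fun n => if n is 0%N then A else B) n).
  by apply: analytic_bigcup => // -[].
apply/seteqP; split=> x; first by case=> ?; [exists 0%N|exists 1%N].
by case=> -[|n] _ ?; [left|right].
Qed.

(** The analytic sets with analytic complement form a sigma-algebra. *)
Lemma sigma_sub_analytic P G : P setT -> P set0 ->
  (forall A, G A -> analytic_set P A /\ analytic_set P (~` A)) ->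
  <<s G >> `<=` analytic_set P.
Proof.
move=> PT P0 GP A sA.
suff: analytic_set P A /\ analytic_set P (~` A) by case.
apply: (sA [set B | analytic_set P B /\ analytic_set P (~` B)]).
split=> //; split.
- by split; [exact: sub_analytic|rewrite setC0; exact: sub_analytic].
- by move=> B [anB anCB]; rewrite setTD; split=> //; rewrite setCK.
move=> F FP; split; first by apply: analytic_bigcup => // n; have [] := FP n.
by rewrite setC_bigcup; apply: analytic_bigcap => // n; have [] := FP n.
Qed.

End souslin.

(** * Capacitability *)

Lemma dependent_choice_seq (G : seq nat -> Prop) : G [::] ->
  (forall s, G s -> exists n, G (rcons s n)) ->
  exists m : nat -> nat, forall k, G (mkseq m k).
Proof.
move=> G0 GS.
have /choice[f fP] : forall s, exists n, G s -> G (rcons s n).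
  by move=> s; have [/GS[n]|] := pselect (G s); [exists n|exists 0%N].
pose S k := iter k (fun s => rcons s (f s)) [::].
exists (fun k => f (S k)) => k.
have -> : mkseq (fun k => f (S k)) k = S k by elim: k => // k; rewrite mkseqS => ->.
by elim: k => //= k; exact: fP.
Qed.

(** The pigeonhole step of Koenig's lemma: if each depth is reached from one of
    finitely many children, one child reaches all depths. *)
Lemma bounded_branching (P : nat -> nat -> Prop) b :
  (forall k n, P k.+1 n -> P k n) ->
  (forall k, exists2 n, (n <= b)%N & P k n) ->
  exists2 n, (n <= b)%N & forall k, P k n.
Proof.
move=> PS; have Pmono k l n : (k <= l)%N -> P l n -> P k n.
  elim: l => [|l IH]; first by rewrite leqn0 => /eqP->.
  by rewrite leq_eqVlt => /orP[/eqP->//|kl /PS]; exact: IH.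
elim: b => [|b IH] bP.
  by exists 0%N => // k; have [n] := bP k; rewrite leqn0 => /eqP ->.
have [Pb|/existsNP[k0 Pk0]] := pselect (forall k, P k b.+1); first by exists b.+1.
have [n nb Pn] : exists2 n, (n <= b)%N & forall k, P k n.
  apply: IH => k; have [n + Pn] := bP (maxn k k0).
  rewrite leq_eqVlt => /orP[/eqP nb|nb].
    by exfalso; apply: Pk0; rewrite -nb; apply: Pmono Pn; rewrite leq_maxr.
  by exists n => //; apply: Pmono Pn; rewrite leq_maxl.
by exists n => //; exact: leqW.
Qed.

Section semianalytic.
Context {R : realType} {T : Type}.
Implicit Types (G : set_system T) (f g : T -> R).

Lemma bounded_realP f :
  (exists a b, forall x, a <= f x <= b) -> bounded_real f.
Proof.
move=> [a [b fab]]; exists (`|a| + `|b|) => x; have /andP[af fb] := fab x.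
rewrite ler_norml; apply/andP; split.
  rewrite lerNl; apply: (@le_trans _ _ (- a)); first by rewrite lerN2.
  by apply: (le_trans (ler_norm _)); rewrite normrN lerDl.
by apply: (le_trans fb); apply: (le_trans (ler_norm b)); rewrite lerDr.
Qed.

Lemma bounded_real_itv f : bounded_real f ->
  exists2 M, 0 < M & forall x, - M <= f x <= M.
Proof.
move=> [M fM]; exists (`|M| + 1); first by rewrite ltr_wpDl.
move=> x; rewrite -ler_norml (le_trans (fM x))// (le_trans (ler_norm _))//.
by rewrite lerDl.
Qed.

Lemma bounded_max f g : bounded_real f -> bounded_real g ->
  bounded_real (fun x => Num.max (f x) (g x)).
Proof.
move=> /bounded_real_itv[M M0 fM] /bounded_real_itv[N N0 gN].
apply: bounded_realP; exists (- M), (Num.max M N) => x.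
have /andP[h1 h2] := fM x; have /andP[h3 h4] := gN x.
by rewrite le_max h1 /= ge_max !le_max h2 h4 orbT.
Qed.

Lemma bounded_min f g : bounded_real f -> bounded_real g ->
  bounded_real (fun x => Num.min (f x) (g x)).
Proof.
move=> /bounded_real_itv[M M0 fM] /bounded_real_itv[N N0 gN].
apply: bounded_realP; exists (Num.min (- M) (- N)), M => x.
have /andP[h1 h2] := fM x; have /andP[h3 h4] := gN x.
by apply/andP; split; [rewrite le_min !ge_min h1 h3 orbT|rewrite ge_min h2].
Qed.

Lemma USAb_cst G (c : R) : G setT -> G set0 -> USAb G (fun=> c).
Proof.
move=> GT G0; split; first by exists `|c|.
move=> d; apply: sub_analytic; have [dc|cd] := leP d c.
  by rewrite [X in G X](_ : _ = setT)//; apply/seteqP; split.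
by rewrite [X in G X](_ : _ = set0)//; apply/seteqP; split.
Qed.

Lemma USAb_max G f g : G setT -> USAb G f -> USAb G g ->
  USAb G (fun x => Num.max (f x) (g x)).
Proof.
move=> GT [bf af] [bg ag]; split; first exact: bounded_max.
move=> c; rewrite [X in analytic_set G X](_ : _ =
    [set x | c <= f x] `|` [set x | c <= g x]).
  by apply: analyticU.
apply/seteqP; split => x /=; rewrite le_max; first by move=> /orP.
by move=> [->|->]; rewrite ?orbT.
Qed.

Lemma USAb_indic G A (a b : R) : G setT -> G set0 -> analytic_set G A -> b <= a ->
  USAb G (fun x => b + (a - b) * \1_A x).
Proof.
move=> GT G0 anA ba; split.
  apply: bounded_realP; exists b, a => x; rewrite indicE; case: (x \in A).
    by rewrite mulr1 addrC subrK lexx ba.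
  by rewrite mulr0 addr0 lexx ba.
move=> c; have [cb|bc] := leP c b.
  rewrite [X in analytic_set G X](_ : _ = setT); first exact: sub_analytic.
  apply/seteqP; split => x //= _.
  by rewrite (le_trans cb)// lerDl mulr_ge0// subr_ge0.
have [ca|ac] := leP c a.
  rewrite [X in analytic_set G X](_ : _ = A) //.
  apply/seteqP; split => x /=; rewrite indicE; last first.
    by move=> /mem_set->; rewrite mulr1 addrC subrK.
  by case: (boolP (x \in A)) => [/set_mem//|_]; rewrite mulr0 addr0 leNgt bc.
rewrite [X in analytic_set G X](_ : _ = set0); first exact: sub_analytic.
apply/seteqP; split => x //=; rewrite indicE; case: (x \in A).
  by rewrite mulr1 addrC subrK leNgt ac.
by rewrite mulr0 addr0 leNgt bc.
Qed.

End semianalytic.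

Section max_limits.
Context {R : realType}.

Lemma cvg_max (I : Type) (F : set_system I) (FF : Filter F) (u v : I -> R)
    (l m : R) : u @ F --> l -> v @ F --> m ->
  Num.max (u n) (v n) @[n --> F] --> Num.max l m.
Proof.
move=> ul vm; rewrite maxr_absE.
under eq_cvg do rewrite maxr_absE.
apply: cvgM; last exact: cvg_cst.
by apply: cvgD; [exact: cvgD|apply: cvg_norm; exact: cvgB].
Qed.

Lemma cvg_min (I : Type) (F : set_system I) (FF : Filter F) (u v : I -> R)
    (l m : R) : u @ F --> l -> v @ F --> m ->
  Num.min (u n) (v n) @[n --> F] --> Num.min l m.
Proof.
move=> ul vm; rewrite minr_absE.
under eq_cvg do rewrite minr_absE.
apply: cvgM; last exact: cvg_cst.
by apply: cvgB; [exact: cvgD|apply: cvg_norm; exact: cvgB].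
Qed.

End max_limits.

Section steps.
Context {R : realType} {T : Type}.
Variables (b : R) (c : nat -> R).
Hypothesis bc : forall i, b <= c i.

(** With indicators [y i] of sets [A i] this is the step function taking the
    largest value [c i] such that the point lies in [A i]. Allowing other [y i]
    lets the indicators be approximated inside the same expression. *)
Fixpoint staircase (n : nat) (y : nat -> T -> R) (x : T) : R :=
  if n is m.+1 then Num.max (staircase m y x) (b + (c m - b) * y m x) else b.

Lemma staircase_closed (Q : set (T -> R)) n y :
  Q (fun=> b) -> (forall f g, Q f -> Q g -> Q (fun x => Num.max (f x) (g x))) ->
  (forall i, Q (fun x => b + (c i - b) * y i x)) -> Q (staircase n y).
Proof.
move=> Qb Qmax Qy; elim: n => // n IH; exact: (Qmax _ _ IH (Qy n)).
Qed.

Lemma staircase_mono n y z x : (forall i, y i x <= z i x) ->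
  staircase n y x <= staircase n z x.
Proof.
move=> yz; elim: n => //= n IH.
rewrite ge_max !le_max IH /= lerD2l ler_wpM2l ?subr_ge0 ?orbT //.
Qed.

Lemma staircase_cvg n (y : nat -> nat -> T -> R) z x :
  (forall i, y k i x @[k --> \oo] --> z i x) ->
  staircase n (y k) x @[k --> \oo] --> staircase n z x.
Proof.
move=> yz; elim: n => [|n IH].
  exact: cvg_cst.
apply: cvg_max => //; apply: cvgD; first exact: cvg_cst.
by apply: cvgM; [exact: cvg_cst|exact: yz].
Qed.

End steps.

Section levels.
Context {R : realType} {T : Type}.
Implicit Types (L : set (T -> R)).

(** In the capacity argument these sets take the part of the compact sets. *)
Definition levels L : set_system T :=
  [set K | exists2 u, L u & K = [set x | 1 <= u x]].

(** Only nonnegative slopes are allowed: the elements of [L] are to be bounded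
    from above by continuous functions, which multiplication by a negative
    number would turn around. *)
Record is_cone_lattice L : Prop := ConeLattice {
  cl_cst : forall c : R, L (fun=> c) ;
  cl_max : forall u v, L u -> L v -> L (fun x => Num.max (u x) (v x)) ;
  cl_min : forall u v, L u -> L v -> L (fun x => Num.min (u x) (v x)) ;
  cl_aff : forall u (a b : R), L u -> 0 <= a -> L (fun x => b + a * u x) }.

Variable L : set (T -> R).
Hypothesis Lcl : is_cone_lattice L.

Lemma levelsT : levels L setT.
Proof.
by exists (fun=> 1); [exact: cl_cst|apply/seteqP; split => x //= _; rewrite lexx].
Qed.

Lemma levels0 : levels L set0.
Proof.
exists (fun=> 0); first exact: cl_cst.
by apply/seteqP; split => x //=; rewrite ler10.
Qed.

Lemma levelsI A B : levels L A -> levels L B -> levels L (A `&` B).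
Proof.
move=> [u Lu ->] [v Lv ->]; exists (fun x => Num.min (u x) (v x)).
  exact: cl_min.
apply/seteqP; split => x /=; rewrite le_min; first by move=> [-> ->].
by move=> /andP.
Qed.

Lemma levelsU A B : levels L A -> levels L B -> levels L (A `|` B).
Proof.
move=> [u Lu ->] [v Lv ->]; exists (fun x => Num.max (u x) (v x)).
  exact: cl_max.
apply/seteqP; split => x /=; rewrite le_max; last by move=> /orP.
by move=> [->|->] //; rewrite orbT.
Qed.

Lemma levels_bounded_union (F : nat -> set T) b : (forall n, levels L (F n)) ->
  levels L [set x | exists2 n, (n <= b)%N & F n x].
Proof.
move=> LF; elim: b => [|b IH].
  rewrite [X in levels L X](_ : _ = F 0%N) //; apply/seteqP; split => x /=.
    by move=> [n]; rewrite leqn0 => /eqP->.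
  by exists 0%N.
rewrite [X in levels L X](_ : _ =
  [set x | exists2 n, (n <= b)%N & F n x] `|` F b.+1); first exact: levelsU.
apply/seteqP; split => x /=.
  move=> [n]; rewrite leq_eqVlt => /orP[/eqP->|nb]; first by right.
  by left; exists n.
by move=> [[n nb]|]; [exists n => //; exact: leqW|exists b.+1].
Qed.

(** Running minima of the functions defining the [V k] fall below 1 exactly off
    the intersection; increasingly steep ramps below the level 1 turn them into
    approximations of its indicator. *)
Lemma levels_indic_approx (V : nat -> set T) : (forall k, levels L (V k)) ->
  exists y : nat -> T -> R, (forall k, L (y k)) /\ forall x,
    [/\ nonincreasing_seq (y ^~ x),
        forall k, (forall j, (j <= k)%N -> V j x) -> y k x = 1,
        forall k, 0 <= y k x &
        y k x @[k --> \oo] --> (\1_(\bigcap_k V k) x : R)].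
Proof.
move=> LV; have /choice[u uP] : forall k, exists u,
  L u /\ V k = [set x | 1 <= u x] by move=> k; have [u] := LV k; exists u.
pose fix v k : T -> R := if k is j.+1 then fun x => Num.min (v j x) (u k x)
  else u 0%N.
have Lv k : L (v k).
  elim: k => [|k IH]; first by have [] := uP 0%N.
  by apply: cl_min => //; have [] := uP k.+1.
have vS k x : v k.+1 x <= v k x by rewrite /= ge_min lexx.
have v1 k x : (forall j, (j <= k)%N -> V j x) -> 1 <= v k x.
  elim: k => [|k IH] Vx.
    by have [_ e] := uP 0%N; have := Vx 0%N isT; rewrite e.
  rewrite /= le_min IH ?andTb; last by move=> j jk; exact/Vx/leqW.
  by have [_ e] := uP k.+1; have := Vx k.+1 (leqnn _); rewrite e.
have vu k j x : (j <= k)%N -> v k x <= u j x.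
  elim: k => [|k IH]; first by rewrite leqn0 => /eqP->.
  rewrite leq_eqVlt => /orP[/eqP->|jk]; first by rewrite /= ge_min lexx orbT.
  exact: le_trans (vS _ _) (IH jk).
(* A ramp of slope k just below the level 1, clipped to [0, 1]. *)
pose y k x := Num.max 0 (Num.min 1 ((1 - k%:R) + k%:R * v k x)).
have yE k x : y k x = Num.max 0 (Num.min 1 (1 + k%:R * (v k x - 1))).
  by rewrite /y mulrBr mulr1 addrAC addrA.
have y1 k x : (forall j, (j <= k)%N -> V j x) -> y k x = 1.
  move=> /v1 vx; rewrite yE min_l ?max_r//.
  by rewrite lerDl mulr_ge0// subr_ge0.
exists y; split=> [k|x].
  apply: (cl_max Lcl); first exact: cl_cst.
  by apply: (cl_min Lcl); [exact: cl_cst|exact: (cl_aff Lcl)].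
split=> //.
- apply/nonincreasing_seqP => k; rewrite !yE ge_max le_max lexx /= le_max.
  apply/orP; right; rewrite le_min ge_min lexx /=.
  have [h|h] := leP 1 (v k x).
    by rewrite ge_min; apply/orP; left; rewrite lerDl mulr_ge0// subr_ge0.
  rewrite ge_min; apply/orP; right; rewrite lerD2l.
  apply: (@le_trans _ _ (k.+1%:R * (v k x - 1))).
    by rewrite ler_wpM2l// lerD2r ge_min lexx.
  by rewrite ler_wnM2r ?ler_nat// subr_le0 ltW.
- by move=> k; exact: y1.
- by move=> k; rewrite yE le_max lexx.
rewrite indicE; have [Vx|] := boolP (x \in _).
  have -> : (fun k => y k x) = fun=> 1.
    apply/funext => k; apply: y1 => j _.
    by have /set_mem := Vx; exact.
  exact: cvg_cst.
move=> /negP Vx; have [j Vj] : exists j, ~ V j x.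
  apply/existsNP => h; apply: Vx; apply/mem_set => j _; exact: h.
have uj : u j x < 1.
  by rewrite ltNge; apply/negP => h; apply: Vj; have [_ ->] := uP j.
apply: cvg_near_cst.
have [N NP] : exists N : nat, (1 - u j x)^-1 <= N%:R.
  by exists (Num.bound (1 - u j x)^-1); 
    rewrite ltW// archi_boundP// invr_ge0 subr_ge0 ltW.
near=> k; rewrite yE; apply: max_l; rewrite ge_min; apply/orP; right.
rewrite -(opprB 1) mulrN subr_le0.
have jk : (j <= k)%N by near: k; exact: nbhs_infty_ge.
have Nk : (N <= k)%N by near: k; exact: nbhs_infty_ge.
apply: (@le_trans _ _ (k%:R * (1 - u j x))); last first.
  by rewrite ler_wpM2l// lerD2l lerN2 vu.
rewrite -ler_pdivrMr ?subr_gt0// mul1r (le_trans NP)// ler_nat //.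
Unshelve. all: by end_near. Qed.

End levels.

Section choquet.
Context {R : realType} {T : Type}.
Variables (G : set_system T) (L : set (T -> R)) (C D : (T -> R) -> R).
Hypothesis GT : G setT.
Hypothesis G0 : G set0.
Hypothesis Lcl : is_cone_lattice L.
Hypothesis L_USAb : forall u, L u -> USAb G u.
Hypothesis C_mono : forall f g, USAb G f -> USAb G g ->
  (forall x, f x <= g x) -> C f <= C g.
Hypothesis D_mono : forall f g, USAb G f -> USAb G g ->
  (forall x, f x <= g x) -> D f <= D g.
Hypothesis C_incr : forall (u : nat -> T -> R) f, (forall n, USAb G (u n)) ->
  USAb G f -> increases_to u f -> forall r, r < C f -> exists n, r < C (u n).
Hypothesis D_decr : forall (u : nat -> T -> R) f, (forall n, L (u n)) ->
  USAb G f -> decreases_to u f -> forall r, (forall n, r <= D (u n)) -> r <= D f.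
Hypothesis CD : forall u, L u -> C u <= D u.
Hypothesis G_an : G `<=` analytic_set (levels L).

(** Truncation of the Souslin scheme [Z] at the branches dominated by [s] on
    the first [size s] coordinates. *)
Let bounded_branches (Z : seq nat -> set T) (s : seq nat) : set T :=
  [set x | exists m : nat -> nat,
    (forall j, (j < size s)%N -> (m j <= nth 0 s j)%N) /\
    forall k, Z (mkseq m k.+1) x].

Let analytic_bounded_branches Z s : (forall r, levels L (Z r)) ->
  analytic_set G (bounded_branches Z s).
Proof.
move=> LZ; have GZ r : analytic_set G (Z r).
  by have [u /L_USAb[_ /(_ 1)] an ->] := LZ r.
apply: analytic_idem => //.
pose ok (r : seq nat) := all (fun j => (nth 0 r j <= nth 0 s j)%N)
  (iota 0 (minn (size r) (size s))).
exists (fun r => if ok r then Z r else set0); split.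
  by move=> r; case: ifP => // _; exact: sub_analytic.
apply/seteqP; split => x.
  move=> [m [ms mZ]]; exists m => // k _ /=; rewrite ifT//.
  apply/allP => j; rewrite mem_iota add0n size_mkseq => /= jk.
  rewrite nth_mkseq; last by rewrite (leq_trans jk)// geq_minl.
  by apply: ms; rewrite (leq_trans jk)// geq_minr.
move=> [m _ mZ]; exists m; split.
  move=> j js; have := mZ j I; case: ifP => //= /allP/(_ j) + _.
  rewrite mem_iota add0n size_mkseq leq_min ltnSn js => /(_ isT).
  by rewrite nth_mkseq.
by move=> k; have := mZ k I => /=; case: ifP.
Qed.

(** Outer approximation of the points with an [m]-bounded branch beyond the node
    [s], looking only [k] levels ahead. Finitely many nodes are involved, so it
    stays among the levels of [L]; the empty sequence carries no condition. *)
Fixpoint thicken (Z : seq nat -> set T) (m : nat -> nat) (k : nat)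
    (s : seq nat) : set T :=
  (if nilp s then setT else Z s) `&`
  (if k is l.+1 then
     [set x | exists2 n, (n <= m (size s))%N & thicken Z m l (rcons s n) x]
   else setT).

Let thicken_levels Z m k s : (forall r, levels L (Z r)) ->
  levels L (thicken Z m k s).
Proof.
move=> LZ; elim: k s => [|k IH] s /=; apply: levelsI => //.
- by case: ifP => // _; exact: levelsT.
- exact: levelsT.
- by case: ifP => // _; exact: levelsT.
- exact: levels_bounded_union.
Qed.

Let thickenS Z m k s : thicken Z m k.+1 s `<=` thicken Z m k s.
Proof.
elim: k s => [|k IH] s x; first by move=> [Zx _]; split.
move=> [Zx [n nm nx]]; split=> //; exists n => //; exact: IH.
Qed.

Let bounded_branches_thicken Z m k :
  bounded_branches Z (mkseq m k) `<=` thicken Z m k [::].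
Proof.
move=> x [t [tm tZ]]; rewrite size_mkseq in tm.
have : forall l j, (j + l <= k)%N -> thicken Z m l (mkseq t j) x.
  elim=> [|l IH] j jk; (split; first by case: j {jk} => // j; exact: tZ) => //.
  exists (t j).
    rewrite size_mkseq -(nth_mkseq 0%N m (i := j) (n := k)).
      by apply: tm; rewrite (leq_trans _ jk)// -addSnnS leq_addr.
    by rewrite (leq_trans _ jk)// -addSnnS leq_addr.
  by rewrite -mkseqS; apply: IH; rewrite addSnnS.
by move=> /(_ k 0%N); exact.
Qed.

(** Koenig's lemma: a point that survives to every finite depth of a finitely
    branching tree lies on an infinite branch. *)
Let thicken_branch Z m : \bigcap_k thicken Z m k [::] `<=`
  [set x | exists t : nat -> nat, forall k, Z (mkseq t k.+1) x].
Proof.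
move=> x xZ; pose good s := forall k, thicken Z m k s x.
have [t tP] : exists t : nat -> nat, forall k, good (mkseq t k).
  apply: dependent_choice_seq; first by move=> k; exact: xZ.
  move=> s gs; have [||n _ ns] := @bounded_branching
      (fun k n => thicken Z m k (rcons s n) x) (m (size s)).
  - by move=> k n; exact: thickenS.
  - by move=> k; have [_] := gs k.+1.
  - by exists n.
by exists t => k; have [] := tP k.+1 0%N.
Qed.

Section steps.
Variables (b : R) (c : nat -> R) (n : nat).
Hypothesis bc : forall i, b <= c i.

Let step (A : nat -> set T) := staircase b c n (fun i => \1_(A i)).

Let USAb_step A : (forall i, analytic_set G (A i)) -> USAb G (step A).
Proof.
move=> anA; apply: staircase_closed => //.
- exact: USAb_cst.
- by move=> f g; exact: USAb_max.
- by move=> i; exact: USAb_indic.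
Qed.

Let step_mono A B x : (forall i, A i `<=` B i) -> step A x <= step B x.
Proof.
move=> AB; apply: staircase_mono => // i; rewrite !indicE ler_nat.
by case: (boolP (x \in A i)) => // /set_mem/AB/mem_set ->.
Qed.

(** Bounds [m] on the branches are chosen one coordinate after the other, each
    so large that, by continuity from below, [C] remains above [r]. The
    [m]-bounded parts of the schemes are finitely branching, so they are
    decreasing limits of levels of [L], along which [D] is continuous from
    above. *)
Lemma choquet_step A : (forall i, analytic_set (levels L) (A i)) ->
  C (step A) <= D (step A).
Proof.
move=> /choice[Z ZA].
have LZ i r : levels L (Z i r) by have [] := ZA i.
have AE i : A i = [set x | exists m : nat -> nat, forall k, Z i (mkseq m k.+1) x].
  have [_ ->] := ZA i; apply/seteqP; split => x.
    by move=> [m _ mx]; exists m => k; exact: mx.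
  by move=> [m mx]; exists m.
pose B s i := bounded_branches (Z i) s.
have anB s i : analytic_set G (B s i) by exact: analytic_bounded_branches.
have A0 : A = B [::].
  apply/funext => i; rewrite AE; apply/seteqP; split => x [m mx].
    by exists m.
  by exists m; have [] := mx.
have anA i : analytic_set G (A i) by rewrite A0.
have BS s i k : B (rcons s k) i `<=` B s i.
  move=> x [m [ms mZ]]; exists m; split=> // j js.
  have := ms j; rewrite size_rcons nth_rcons js => /(_ (leqW js)).
  exact.
have Bmono s i k l : (k <= l)%N -> B (rcons s k) i `<=` B (rcons s l) i.
  move=> kl x [m [ms mZ]]; exists m; split=> // j js.
  apply: leq_trans (ms j _) _; first by rewrite !size_rcons in js *.
  rewrite !nth_rcons; case: ifP => // _; case: ifP => // _.
have levels_an K : levels L K -> analytic_set G K.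
  by move=> [u /L_USAb[_ /(_ 1)] an ->].
rewrite leNgt; apply/negP => /midf_lt[+ +].
set r := _ / _ => Dr rC.
have [m mP] : exists m : nat -> nat, forall k, r < C (step (B (mkseq m k))).
  apply: (@dependent_choice_seq (fun s => r < C (step (B s)))).
    by rewrite -A0.
  move=> s rs; apply: (C_incr (f := step (B s))) => //.
  - by move=> k; apply: USAb_step => i; exact: anB.
  - by apply: USAb_step => i; exact: anB.
  split=> x; first by move=> k l kl; apply: step_mono => i; exact: Bmono.
  apply: staircase_cvg => i; apply: cvg_near_cst; rewrite !indicE.
  have [|xs] := boolP (x \in B s i).
    move=> /set_mem[t [ts tZ]]; exists (t (size s)) => //= k /= tk.
    rewrite indicE mem_set//; exists t; split=> // j.
    rewrite size_rcons ltnS leq_eqVlt nth_rcons => /orP[/eqP->|js].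
      by rewrite ltnn eqxx.
    by rewrite js; exact: ts.
  near=> k; rewrite indicE memNset// => /BS xB.
  by move/negP: xs; apply; exact/mem_set.
have /choice[y yP] := fun i => levels_indic_approx Lcl
  (fun k => thicken_levels m k [::] (LZ i)).
pose u k := staircase b c n (fun i => y i k).
have Lu k : L (u k).
  apply: staircase_closed.
  - exact: (cl_cst Lcl).
  - exact: (cl_max Lcl).
  - move=> i; apply: (cl_aff Lcl); last by rewrite subr_ge0.
    by have [] := yP i.
pose K i := \bigcap_k thicken (Z i) m k [::].
have UK : USAb G (step K).
  apply: USAb_step => i; apply: analytic_bigcap => // k.
  by apply: levels_an; exact: thicken_levels.
suff : r <= D (step K).
  apply/negP; rewrite -ltNge; apply: le_lt_trans Dr; apply: D_mono => //.
    exact: USAb_step.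
  move=> x; apply: step_mono => i; rewrite AE; exact: thicken_branch.
apply: (D_decr (u := u)) => //.
  split=> x.
    move=> k l kl; apply: staircase_mono => // i.
    by have [_ /(_ x)[+ _ _ _]] := yP i; exact.
  apply: staircase_cvg => i.
  by have [_ /(_ x)[]] := yP i.
move=> k; apply: le_trans (CD (Lu k)); apply/ltW/(lt_le_trans (mP k)).
apply: C_mono; [by apply: USAb_step => i; exact: anB|exact: L_USAb|].
move=> x; apply: staircase_mono => // i; rewrite indicE.
have [_ /(_ x)[_ y1 y0 _]] := yP i.
have [/set_mem xB|//] := boolP (x \in B (mkseq m k) i).
rewrite y1// => j jk; apply: bounded_branches_thicken.
move: xB => [t [tm tZ]]; exists t; split=> // l; rewrite size_mkseq => lj.
rewrite nth_mkseq//; have := tm l.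
by rewrite size_mkseq nth_mkseq ?(leq_trans lj)//; exact.
Unshelve. all: by end_near. Qed.

End steps.

(** A semianalytic function is the increasing limit of its staircases over more
    and more rational levels, so continuity of [C] from below reduces the claim
    to staircases. *)
Theorem choquet_comparison f : USAb G f -> C f <= D f.
Proof.
move=> Uf; have [/bounded_real_itv[M M0 fM] fan] := Uf.
have Mf x : - M <= f x by have /andP[] := fM x.
pose c i : R := Num.max (ratr (odflt 0 (@unpickle rat i))) (- M).
have bc i : - M <= c i by rewrite le_max lexx orbT.
pose A i := [set x | c i <= f x].
pose u n := staircase (- M) c n (fun i => \1_(A i)).
have uf n x : u n x <= f x.
  elim: n => [|n IH]; first exact: Mf.
  rewrite /u /= ge_max IH /= indicE; case: (boolP (x \in A n)) => [/set_mem|_].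
    by rewrite mulr1 addrC subrK.
  by rewrite mulr0 addr0.
have umono x : nondecreasing_seq (u ^~ x).
  by apply/nondecreasing_seqP => n; rewrite /u /= le_max lexx.
have Uu n : USAb G (u n).
  apply: staircase_closed => //; first exact: USAb_cst.
    by move=> g h; exact: USAb_max.
  by move=> i; apply: USAb_indic => //; exact: fan.
have uinc : increases_to u f.
  split=> // x; apply/cvgrPdist_le => e e0.
  have [q /andP[fq qf]] : exists q : rat, f x - e < ratr q < f x.
    have /rat_in_itvoo[q] : f x - e < f x by rewrite gtrBl.
    by rewrite inE => qi; exists q.
  pose N := (pickle q).+1.
  near=> n; have Nn : (N <= n)%N by near: n; exact: nbhs_infty_ge.
  rewrite ger0_norm ?subr_ge0// lerBlDl -lerBlDr.
  apply: (@le_trans _ _ (c (pickle q))).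
    by rewrite /c pickleK /= le_max (ltW fq).
  apply: le_trans (umono x _ _ Nn).
  rewrite /u /= le_max indicE mem_set ?mulr1 ?[- M + _]addrC ?subrK ?lexx ?orbT//.
  by rewrite /A /= /c pickleK /= ge_max (ltW qf) Mf.
rewrite leNgt; apply/negP => /(C_incr Uu Uf uinc)[n].
rewrite ltNge => /negP; apply; apply: (@le_trans _ _ (D (u n))); last exact: D_mono.
apply: choquet_step => // i; apply: analytic_idem; first exact: levelsT.
exact: (analyticS G_an (fan (c i))).
Unshelve. all: by end_near. Qed.

End choquet.

(** * Bounded measurable functions *)

Section bounded_measurable.
Context {R : realType} {T : Type}.
Variable G : set_system T.
Hypothesis sG : sigma_algebra setT G.
Implicit Types (A B : set T) (f g : T -> R).

Lemma salg0 : G set0. Proof. by case: sG. Qed.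

Lemma salgC A : G A -> G (~` A).
Proof. by case: sG => _ GC _ /GC; rewrite setTD. Qed.

Lemma salgT : G setT. Proof. by rewrite -setC0; exact/salgC/salg0. Qed.

Lemma salg_bigcup (A : nat -> set T) : (forall n, G (A n)) -> G (\bigcup_n A n).
Proof. by case: sG => _ _; exact. Qed.

Lemma salg_bigcap (A : nat -> set T) : (forall n, G (A n)) -> G (\bigcap_n A n).
Proof.
move=> GA; rewrite -[X in G X]setCK setC_bigcap.
by apply: salgC; apply: salg_bigcup => n; exact: salgC.
Qed.

Lemma salgU A B : G A -> G B -> G (A `|` B).
Proof.
move=> GA GB; rewrite -bigcup2E; apply: salg_bigcup => -[|[|n]] //=.
exact: salg0.
Qed.

Lemma salgI A B : G A -> G B -> G (A `&` B).
Proof.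
move=> GA GB; rewrite -[X in G X]setCK setCI.
by apply: salgC; apply: salgU; exact: salgC.
Qed.

Lemma salg_countable_union (I : countType) (A : I -> set T) (P : set I) :
  (forall i, P i -> G (A i)) -> G (\bigcup_(i in P) A i).
Proof.
move=> GA; rewrite [X in G X](_ : _ = \bigcup_n
    (if @unpickle I n is Some i then [set x | P i /\ A i x] else set0)).
  apply: salg_bigcup => n; case: unpickle => [i|]; last exact: salg0.
  have [Pi|nPi] := pselect (P i).
    rewrite [X in G X](_ : _ = A i); first exact: GA.
    by apply/seteqP; split => x //= -[].
  rewrite [X in G X](_ : _ = set0); first exact: salg0.
  by apply/seteqP; split => x //= -[].
apply/seteqP; split => x.
  by move=> [i Pi Aix]; exists (pickle i) => //; rewrite pickleK.
by move=> [n _]; case: unpickle => // i [Pi Aix]; exists i.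
Qed.

Lemma salg_finite_inter (n : nat) (A : 'I_n -> set T) :
  (forall i, G (A i)) -> G [set x | forall i, A i x].
Proof.
move=> GA; rewrite [X in G X](_ : _ = ~` \bigcup_(i in setT) ~` A i).
  by apply/salgC/salg_countable_union => i _; exact/salgC.
rewrite setC_bigcup; apply/seteqP; split => x Ax i.
  by move=> _; rewrite setCK; exact: Ax.
by have := Ax i I; rewrite setCK.
Qed.

Definition bounded_measurable f := bounded_real f /\ forall c, G [set x | c <= f x].

Lemma bounded_measurable_USAb f : bounded_measurable f -> USAb G f.
Proof. by move=> [bf mf]; split=> // c; exact: sub_analytic. Qed.

Lemma bounded_measurable_cst (c : R) : bounded_measurable (fun=> c).
Proof.
split; first by exists `|c|.
move=> d; have [dc|cd] := leP d c.
  by rewrite [X in G X](_ : _ = setT); [exact: salgT|apply/seteqP; split].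
by rewrite [X in G X](_ : _ = set0); [exact: salg0|apply/seteqP; split].
Qed.

Lemma bounded_measurable_max f g : bounded_measurable f -> bounded_measurable g ->
  bounded_measurable (fun x => Num.max (f x) (g x)).
Proof.
move=> [bf mf] [bg mg]; split; first exact: bounded_max.
move=> c; rewrite [X in G X](_ : _ = [set x | c <= f x] `|` [set x | c <= g x]).
  exact: salgU.
apply/seteqP; split => x /=; rewrite le_max; first by move=> /orP.
by move=> [->|->]; rewrite ?orbT.
Qed.

Lemma bounded_measurable_min f g : bounded_measurable f -> bounded_measurable g ->
  bounded_measurable (fun x => Num.min (f x) (g x)).
Proof.
move=> [bf mf] [bg mg]; split; first exact: bounded_min.
move=> c; rewrite [X in G X](_ : _ = [set x | c <= f x] `&` [set x | c <= g x]).
  exact: salgI.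
apply/seteqP; split => x /=; rewrite le_min; first by move=> /andP.
by move=> [-> ->].
Qed.

Lemma bounded_affine f (a b : R) : bounded_real f ->
  bounded_real (fun x => b + a * f x).
Proof.
move=> [M fM]; exists (`|b| + `|a| * M) => x; apply: (le_trans (ler_normD _ _)).
by rewrite lerD2l normrM ler_wpM2l.
Qed.

Lemma bounded_measurable_affine f (a b : R) : 0 <= a -> bounded_measurable f ->
  bounded_measurable (fun x => b + a * f x).
Proof.
rewrite le_eqVlt => /orP[/eqP <- _|a0 [bf mf]].
  rewrite (_ : (fun=> _) = fun=> b); first exact: bounded_measurable_cst.
  by apply/funext => x; rewrite mul0r addr0.
split=> [|c]; first exact: bounded_affine.
rewrite [X in G X](_ : _ = [set x | (c - b) / a <= f x]); first exact: mf.
by apply/seteqP; split => x /=; rewrite ler_pdivrMr// lerBlDl mulrC.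
Qed.

Lemma bounded_measurable_add_indic f (a : R) A : G A -> bounded_measurable f ->
  bounded_measurable (fun x => f x + a * \1_A x).
Proof.
move=> GA [bf mf]; split.
  have [M fM] := bf; exists (M + `|a|) => x; apply: (le_trans (ler_normD _ _)).
  rewrite lerD// normrM indicE; case: (x \in A).
    by rewrite normr1 mulr1.
  by rewrite normr0 mulr0.
move=> c; rewrite [X in G X](_ : _ = (A `&` [set x | c - a <= f x]) `|`
    (~` A `&` [set x | c <= f x])).
  by apply: salgU; apply: salgI => //; exact: salgC.
apply/seteqP; split => x /=; rewrite indicE.
  have [/set_mem Ax|/negP Ax] := boolP (x \in A).
    by rewrite mulr1 -lerBlDr; left.
  by rewrite mulr0 addr0; right; split=> // /mem_set.
case=> -[Ax]; first by rewrite mem_set// mulr1 -lerBlDr.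
by rewrite memNset// mulr0 addr0.
Qed.

Lemma bounded_measurable_indic (a : R) A : G A ->
  bounded_measurable (fun x => a * \1_A x).
Proof.
move=> GA; rewrite (_ : (fun=> _) = fun x => 0 + a * \1_A x).
  by apply: bounded_measurable_add_indic => //; exact: bounded_measurable_cst.
by apply/funext => x; rewrite add0r.
Qed.

Lemma bounded_measurable_decreasing_limit (u : nat -> T -> R) f :
  (forall n, bounded_measurable (u n)) -> bounded_real f -> decreases_to u f ->
  bounded_measurable f.
Proof.
move=> mu bf [u_dec u_f]; split=> // c.
rewrite [X in G X](_ : _ = \bigcap_n [set x | c <= u n x]).
  by apply: salg_bigcap => n; have [] := mu n.
apply/seteqP; split => x /= cx.
  move=> n _ /=; apply: (le_trans cx); rewrite -(cvg_lim _ (u_f x))//.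
  by apply: nonincreasing_cvgn_ge => //; apply/cvg_ex; exists (f x).
rewrite -(cvg_lim _ (u_f x))//; apply: limr_ge.
  by apply/cvg_ex; exists (f x).
by apply: nearW => n; exact: cx.
Qed.

End bounded_measurable.

(** Preimages of open subsets of a finite power of a separable metric space:
    such a set is a countable union of boxes of balls with dense centres. *)
Lemma salg_coordinates {R : realType} {E : metricType R} {T : Type}
    (G : set_system T) (n : nat) (X : 'I_n -> T -> E) :
  separable_complete E -> sigma_algebra setT G ->
  (forall i B, borel B -> G [set w | B (X i w)]) ->
  forall U : set 'rV[E]_n, open U -> G [set w | U (\row_i X i w)].
Proof.
move=> [[Q /countable_injP[c cinj] Qd] _] sG GX U oU.
pose cell (m : nat) (k : nat) : set E :=
  [set x | exists d, [/\ Q d, c d = m & ball d k.+1%:R^-1 x]].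
have ocell m k : open (cell m k).
  have -> : cell m k = \bigcup_(d in [set d | Q d /\ c d = m]) ball d k.+1%:R^-1.
    by apply/seteqP; split => x [d]; [case=> *; exists d|case=> *; exists d].
  apply: bigcup_open => d _; rewrite ballEmdist openE => x /= dx.
  apply/nbhs_ballP; exists (k.+1%:R^-1 - mdist d x) => /=; first by rewrite subr_gt0.
  move=> y; rewrite ballEmdist /= ltrBrDl => xy.
  by apply: le_lt_trans xy; exact: metric_triangle.
pose good := [set p : {ffun 'I_n -> nat} * nat |
  forall x : 'rV[E]_n, (forall i, cell (p.1 i) p.2 (x ord0 i)) -> U x].
rewrite [X in G X](_ : _ = \bigcup_(p in good)
    [set w | forall i, cell (p.1 i) p.2 (X i w)]).
  apply: salg_countable_union => // p _; apply: salg_finite_inter => // i.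
  by apply: GX; exact: sub_sigma_algebra.
apply/seteqP; split => w /=; last first.
  by move=> [p gp wp]; apply: gp => i; rewrite mxE; exact: wp.
move=> Uw; have /nbhs_ballP[e /= e0 eU] : nbhs (\row_i X i w) U.
  by move: oU; rewrite openE; exact.
pose k := Num.bound (2 / e).
have ke : k.+1%:R^-1 < e / 2.
  rewrite -[e / 2]invrK invf_div ltf_pV2 ?posrE ?divr_gt0//.
  apply: (lt_trans (archi_boundP _)); first by rewrite divr_ge0// ltW.
  by rewrite ltr_nat.
have /choice[d dP] : forall i, exists d, Q d /\ ball d k.+1%:R^-1 (X i w).
  move=> i; have : (ball (X i w) k.+1%:R^-1)^° `&` Q !=set0.
    apply: Qd; last exact: open_interior.
    by exists (X i w); apply: nbhsx_ballx; rewrite invr_gt0.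
  by move=> [d [/interior_subset dx Qd']]; exists d; split=> //; exact: ball_sym.
exists ([ffun i => c (d i)], k); last first.
  by move=> i; rewrite ffunE; exists (d i); have [] := dP i.
move=> x xP; apply: eU; split=> // i j; rewrite (ord1 i) mxE.
have [d' [Qd' + d'x]] := xP j; have [Qdj dj] := dP j.
rewrite ffunE => /cinj dd; rewrite dd ?inE// in d'x.
have := ball_triangle (ball_sym dj) d'x; apply: le_ball.
by rewrite (splitr e) lerD// ltW.
Qed.

(** * Measurability on path space *)

Section path_measurability.
Context {R : realType} {E : metricType R} {k : path_kind}.
Local Notation Omega := (pathT E k).

Lemma sF_salg : sigma_algebra setT (sF E k).
Proof. exact: smallest_sigma_algebra. Qed.

Lemma sFt_salg t : sigma_algebra setT (sFt E k t).
Proof. exact: smallest_sigma_algebra. Qed.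

Lemma coord_sF s (B : set E) : borel B -> sF E k [set w | B (w s)].
Proof. by move=> bB; apply: sub_sigma_algebra; exists s, B. Qed.

Lemma coord_sFt s t (B : set E) : s <= t -> borel B ->
  sFt E k t [set w | B (w s)].
Proof. by move=> st bB; apply: sub_sigma_algebra; exists s, B. Qed.

Lemma sFt_sub t : sFt E k t `<=` sF E k.
Proof.
by apply: sub_sigma_algebra2 => A [s [B [_ bB ->]]]; exists s, B.
Qed.

Lemma borel_open (T : topologicalType) (U : set T) : open U -> borel U.
Proof. exact: sub_sigma_algebra. Qed.

Lemma borel_neq (x : E) : borel [set y : E | y <> x].
Proof.
apply: borel_open; rewrite openE => y /= yx; apply/nbhs_ballP.
exists (mdist y x) => /=; first by rewrite mdist_gt0; exact/eqP.
by move=> z; rewrite ballEmdist /= => yz zx; rewrite zx ltxx in yz.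
Qed.

Lemma continuous_open_lt (T : topologicalType) (f : T -> R) c :
  continuous f -> open [set x | f x < c].
Proof.
by move=> /continuousP cf; exact: (cf [set y | y < c] (@open_lt R c)).
Qed.

Lemma measurable_cylinder (G : set_system Omega) (n : nat) (tau : 'I_n -> R)
    (f : 'rV[E]_n -> R) : separable_complete E -> sigma_algebra setT G ->
  (forall i B, borel B -> G [set w | B (w (tau i))]) -> Cb f ->
  bounded_measurable G (fun w : Omega => f (\row_i w (tau i))).
Proof.
move=> Epol sG Gtau [[M fM] cf]; split; first by exists M => w; exact: fM.
move=> c; have := @salg_coordinates _ _ _ _ _ (fun i (w : Omega) => w (tau i))
  Epol sG Gtau _ (continuous_open_lt c cf).
move=> /(salgC sG); congr G; apply/seteqP.
by split => w /= => [/negP|h]; [|apply/negP]; rewrite -leNgt.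
Qed.

Lemma path_cadlag (w : Omega) : cadlag w.
Proof.
case: w; case: k => //= w wc t; split; first exact/cvg_at_right_filter/wc.
by exists (w t); exact/cvg_at_left_filter/wc.
Qed.

Lemma cvg_left_harmonic (s : R) :
  (s - n.+1%:R^-1) @[n --> \oo] --> s^'-.
Proof.
move=> A [e /= e0 eA].
suff : \forall n \near \oo, A (s - n.+1%:R^-1) by [].
near=> n; apply: eA => /=; last by rewrite gtrBl invr_gt0.
rewrite opprB addrC subrK ger0_norm ?invr_ge0//.
by near: n; exact: (near_infty_natSinv_lt (PosNum e0)).
Unshelve. all: by end_near. Qed.

Lemma open_mdist_gt (c : R) :
  open [set x : 'rV[E]_2 | c < mdist (x ord0 ord0) (x ord0 ord_max)].
Proof.
rewrite openE => x /= cx; apply/nbhs_ballP.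
set r := mdist _ _ in cx; exists ((r - c) / 2) => /=.
  by rewrite divr_gt0// subr_gt0.
move=> y [_ xy]; have := xy ord0 ord0; have := xy ord0 ord_max.
rewrite !ballEmdist /= => h1 h0.
have h : r <= mdist (x ord0 ord0) (y ord0 ord0) +
    (mdist (y ord0 ord0) (y ord0 ord_max) + mdist (x ord0 ord_max) (y ord0 ord_max)).
  apply: le_trans (metric_triangle _ (y ord0 ord0) _) _; rewrite lerD2l.
  apply: le_trans (metric_triangle _ (y ord0 ord_max) _) _; rewrite lerD2l.
  by rewrite metric_sym.
move: h h0 h1; clear; lra.
Qed.

(** As left limits exist, a jump at [s] is detected along the single sequence
    of times [s - 1 / n]. *)
Lemma measurable_jump_at s : separable_complete E -> sF E k (jump_at E k s).
Proof.
move=> Epol; have sG := sF_salg.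
have Gdist c a b : sF E k [set w : Omega | c < mdist (w a) (w b)].
  have := @salg_coordinates _ _ _ _ 2
    (fun i (w : Omega) => w (if i == ord0 then a else b))
    Epol sG (fun i B bB => coord_sF (if i == ord0 then a else b) bB) _
    (@open_mdist_gt c).
  by congr sF; apply/seteqP; split => w /=; rewrite !mxE.
rewrite [X in sF E k X](_ : _ = \bigcup_m \bigcup_N \bigcap_n
    [set w : Omega | m.+1%:R^-1 < mdist (w (s - (N + n).+1%:R^-1)) (w s)]).
  by do 2 (apply: salg_bigcup => // ?); apply: salg_bigcap => // ?; exact: Gdist.
apply/seteqP; split => w /=.
  move=> [l wl ls]; have l0 : 0 < mdist l (w s).
    by rewrite mdist_gt0; apply/eqP => e; exact/ls.
  pose m := Num.bound (2 / mdist l (w s)).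
  have me : m.+1%:R^-1 < mdist l (w s) / 2.
    rewrite -[_ / 2]invrK invf_div ltf_pV2 ?posrE ?divr_gt0//.
    apply: (lt_trans (archi_boundP _)); first by rewrite divr_ge0// ltW.
    by rewrite ltr_nat.
  have wn := cvg_comp _ _ (@cvg_left_harmonic s) wl.
  have /cvg_ballP/(_ (mdist l (w s) / 2)) := wn.
  rewrite divr_gt0// => /(_ isT) [N _ NP].
  exists m => //; exists N => // n _ /=.
  have := NP (N + n)%N (leq_addr _ _); rewrite /= ballEmdist /= => h.
  have h2 := metric_triangle l (w (s - (N + n).+1%:R^-1)) (w s).
  by apply: (lt_trans me); move: h h2; clear; lra.
move=> [m _ [N _ h]]; have [_ [l wl]] := path_cadlag w s.
exists l => // ls.
have wn := cvg_comp _ _ (@cvg_left_harmonic s) wl.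
have /cvg_ballP/(_ m.+1%:R^-1) := wn; rewrite invr_gt0 ltr0n => /(_ isT)[N' _ NP].
have := NP (N + N')%N (leq_addl _ _); rewrite /= ballEmdist /= -ls metric_sym.
by have := h N' I => /= /lt_trans/[apply]; rewrite ltxx.
Qed.

End path_measurability.

(** * Negligible sets of a convex expectation *)

Section cexp_null.
Context {R : realType} {E : metricType R} {k : path_kind}.
Local Notation Omega := (pathT E k).
Variable calE : R -> (Omega -> R) -> Omega -> R.
Hypothesis calE_cexp : convex_expectation calE.
Variables (t : R) (w : Omega).

(** Null sets for the evaluation at [(t, w)]. All multiples of the indicator
    are tested because a convex expectation need not be positively
    homogeneous. *)
Definition cexp_null (N : set Omega) : Prop :=
  sF E k N /\ forall a : R, 0 < a -> calE t (fun w' => a * \1_N w') w <= 0.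

Let bmeas (f : Omega -> R) := bounded_measurable (sF E k) f.

Let bmeas_USAb f : bmeas f -> USAb (sF E k) f.
Proof. exact: bounded_measurable_USAb. Qed.

Lemma cexp_mono_measurable f g : bmeas f -> bmeas g ->
  (forall w', f w' <= g w') -> calE t f w <= calE t g w.
Proof. by move=> mf mg fg; apply: (cexp_mono calE_cexp) => //; exact: bmeas_USAb. Qed.

(** With a bound [a] of [f - g], the function [f] is below [g + a 1_N], which is
    the convex combination of [g] with weight [1 - d] and [g + (a / d) 1_N] with
    weight [d]. The expectation of the latter is bounded independently of [d],
    again by convexity, since [N] is null; let [d] tend to [0]. *)
Lemma cexp_null_le N f g : cexp_null N -> bmeas f -> bmeas g ->
  (forall w', ~ N w' -> f w' <= g w') -> calE t f w <= calE t g w.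
Proof.
move=> [FN N0] mf mg fg; have sG := @sF_salg R E k.
have [/bounded_real_itv[M M0 fM] _] := mf.
have [/bounded_real_itv[M' M'0 gM] _] := mg.
pose a := M + M'; have a0 : 0 < a by rewrite addr_gt0.
have m2g : bmeas (fun w' => 0 + 2 * g w') by exact: bounded_measurable_affine.
pose K := 2^-1 * calE t (fun w' => 0 + 2 * g w') w.
have h1 d : 0 < d < 1 ->
    calE t f w <= (1 - d) * calE t g w + (1 - (1 - d)) * K.
  move=> /andP[d0 d1].
  have mN : bmeas (fun w' => (2 * (a / d)) * \1_N w').
    exact: bounded_measurable_indic.
  have mgN : bmeas (fun w' => g w' + (a / d) * \1_N w').
    exact: bounded_measurable_add_indic.
  have h2 : calE t (fun w' => g w' + (a / d) * \1_N w') w <= K.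
    have := cexp_convex calE_cexp t (bmeas_USAb m2g) (bmeas_USAb mN)
      (lam := 2^-1) _ w.
    rewrite [X in calE t X w](_ : _ = fun w' => g w' + (a / d) * \1_N w').
      move=> /(_ ltac:(by apply/andP; split; lra)) h; apply: (le_trans h).
      rewrite gerDl mulr_ge0_le0 ?N0//; first by lra.
      by rewrite mulr_gt0// divr_gt0.
    by apply/funext => w'; field; lra.
  have h3 := cexp_convex calE_cexp t (bmeas_USAb mg) (bmeas_USAb mgN)
      (lam := 1 - d) _ w.
  apply: (@le_trans _ _ ((1 - d) * calE t g w + (1 - (1 - d)) *
      calE t (fun w' => g w' + (a / d) * \1_N w') w)); last first.
    by rewrite lerD2l ler_wpM2l//; lra.
  apply: (le_trans _ (h3 _)); last by apply/andP; split; lra.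
  apply: cexp_mono_measurable => //.
    rewrite (_ : (fun w' => _) = fun w' => g w' + a * \1_N w').
      exact: bounded_measurable_add_indic.
    by apply/funext => w'; field; lra.
  move=> w'; have [/set_mem Nw|/negP Nw] := boolP (w' \in N).
    rewrite indicE mem_set// mulr1.
    have -> : (1 - d) * g w' + (1 - (1 - d)) * (g w' + a / d) = g w' + a.
      by field; lra.
    have /andP[_ fw] := fM w'; have /andP[gw _] := gM w'; rewrite /a; lra.
  rewrite indicE memNset; last by move=> Nw'; apply: Nw; exact/mem_set.
  rewrite mulr0 addr0 (_ : _ + _ = g w'); last by ring.
  by apply: fg => Nw'; apply: Nw; exact/mem_set.
rewrite leNgt; apply/negP => gf.
pose x := calE t f w - calE t g w; pose y := K - calE t g w.
have h d : 0 < d < 1 -> x <= d * y.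
  by move=> /h1; rewrite /x /y; set p := calE t f w; set q := calE t g w; lra.
have x0 : 0 < x by rewrite subr_gt0.
have y0 : 0 < y by have := h 2^-1 ltac:(by apply/andP; split; lra); lra.
have : x <= x / (2 * y) * y.
  apply: (h _ _); rewrite divr_gt0 ?mulr_gt0//= ltr_pdivrMr ?mulr_gt0// mul1r.
  by have := h 2^-1 ltac:(by apply/andP; split; lra); lra.
by rewrite (_ : x / (2 * y) * y = x / 2); [move=> x2; lra|field; rewrite gt_eqF].
Qed.

Lemma cexp_null0 : cexp_null set0.
Proof.
split=> [|a a0]; first exact: (salg0 (@sF_salg R E k)).
rewrite (cexp_id calE_cexp); first by rewrite indicE memNset// mulr0.
apply: bounded_measurable_USAb; apply: bounded_measurable_indic.
  exact: sFt_salg.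
exact: (salg0 (@sFt_salg R E k t)).
Qed.

Lemma cexp_nullU A B : cexp_null A -> cexp_null B -> cexp_null (A `|` B).
Proof.
move=> [FA A0] [FB B0]; have sG := @sF_salg R E k.
have FAB : sF E k (A `|` B) by exact: (salgU sG FA FB).
split=> // a a0.
have mA : bmeas (fun w' => (2 * a) * \1_A w') by exact: bounded_measurable_indic.
have mB : bmeas (fun w' => (2 * a) * \1_B w') by exact: bounded_measurable_indic.
have h := cexp_convex calE_cexp t (bmeas_USAb mA) (bmeas_USAb mB)
    (lam := 2^-1) ltac:(by apply/andP; split; lra) w.
have a20 : 0 < 2 * a by lra.
apply: le_trans (le_trans _ h) _.
  apply: cexp_mono_measurable; first exact: bounded_measurable_indic.
    rewrite (_ : (fun w' => _) = fun w' => a * \1_A w' + a * \1_B w').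
      apply: bounded_measurable_add_indic => //.
      exact: bounded_measurable_indic.
    by apply/funext => w'; field.
  move=> w'; rewrite !indicE in_setU.
  by case: (w' \in A); case: (w' \in B); rewrite /= ?mulr1n ?mulr0n; lra.
by have := A0 _ a20; have := B0 _ a20; lra.
Qed.

Lemma cexp_null_bigcup (N : nat -> set Omega) :
  (forall n, cexp_null (N n)) -> cexp_null (\bigcup_n N n).
Proof.
move=> negN; have sG := @sF_salg R E k.
pose fix U n := if n is m.+1 then U m `|` N m else set0.
have negU n : cexp_null (U n).
  by elim: n => [|n IH]; [exact: cexp_null0|exact: cexp_nullU].
have FN : sF E k (\bigcup_n N n) by apply: salg_bigcup => // n; have [] := negN n.
have UN n : U n `<=` \bigcup_n N n.
  by elim: n => //= n IH x [/IH|Nx] //; exists n.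
have Umono n m : (n <= m)%N -> U n `<=` U m.
  elim: m => [|m IH]; first by rewrite leqn0 => /eqP->.
  by rewrite leq_eqVlt => /orP[/eqP->//|/IH nm] x /nm ?; left.
split=> // a a0.
have inc : increases_to (fun n w' => a * \1_(U n) w' : R)
    (fun w' => a * \1_(\bigcup_n N n) w').
  split=> w'.
    move=> n m nm; rewrite ler_pM2l// !indicE ler_nat.
    by case: (boolP (w' \in U n)) => // /set_mem/(Umono _ _ nm)/mem_set ->.
  apply: cvg_near_cst; have [|] := boolP (w' \in \bigcup_n N n).
    move=> w'N; have /set_mem[n _ Nn] := w'N; exists n.+1 => //= m nm.
    by rewrite !indicE w'N mem_set//; apply: Umono nm _ _; right.
  move=> /negP w'N; near=> n; rewrite !indicE !memNset//.
    by move=> ?; apply: w'N; exact/mem_set.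
  by move=> /UN ?; apply: w'N; exact/mem_set.
have [_ h] := cexp_incr calE_cexp t
  (fun n => bmeas_USAb (bounded_measurable_indic sG a (proj1 (negU n))))
  (bmeas_USAb (bounded_measurable_indic sG a FN)) inc.
rewrite -(cvg_lim _ (h w))//; apply: limr_le.
  by apply/cvg_ex; eexists; exact: (h w).
by apply: nearW => n; have [_] := negU n; exact.
Unshelve. all: by end_near. Qed.

(** Up to the present time [t] the conditioning path is known. *)
Lemma cexp_null_past s : s <= t -> cexp_null [set w' : Omega | w' s <> w s].
Proof.
move=> st; have FtN : sFt E k t [set w' : Omega | w' s <> w s].
  by apply: (coord_sFt (B := [set y | y <> w s])) => //; exact: borel_neq.
split=> [|a a0]; first exact: (sFt_sub FtN).
rewrite (cexp_id calE_cexp).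
  by rewrite indicE memNset ?mulr0//; exact.
apply: bounded_measurable_USAb; apply: bounded_measurable_indic => //.
exact: sFt_salg.
Qed.

Lemma cexp_null_jump s : separable_complete E -> no_fixed_discontinuity calE ->
  t < s -> cexp_null (jump_at E k s).
Proof.
move=> Epol nofix ts; split; first exact: measurable_jump_at.
by move=> a a0; rewrite nofix.
Qed.

End cexp_null.

(** * Comparison on cylinder functions *)

Lemma nonexpansive_continuous {R : realType} (S T : pseudoMetricType R) (F : S -> T) :
  (forall x y e, 0 < e -> ball x e y -> ball (F x) e (F y)) -> continuous F.
Proof.
move=> Fball x; apply/cvg_ballP => e e0.
by near=> y; apply: Fball => //; near: y; exact: nbhsx_ballx.
Unshelve. all: by end_near. Qed.

Lemma Cb_comp {R : realType} (S T : topologicalType) (F : S -> T) (f : T -> R) :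
  continuous F -> Cb f -> Cb (f \o F).
Proof.
move=> cF [[M fM] cf]; split; first by exists M => x; exact: fM.
by move=> x; apply: continuous_comp; [exact: cF|exact: cf].
Qed.

Section coordinate_rows.
Context {R : realType} {E : metricType R}.

Lemma continuous_reindex n m (h : 'I_n -> 'I_m) :
  continuous (fun x : 'rV[E]_m => \row_i x ord0 (h i)).
Proof.
apply: nonexpansive_continuous => x y e e0 [_ xy]; split=> // i j.
by rewrite !mxE; exact: xy.
Qed.

Lemma continuous_row_mxr n (x : 'rV[E]_n) :
  continuous (fun y : E => row_mx x (const_mx y : 'rV[E]_1)).
Proof.
apply: nonexpansive_continuous => y z e e0 yz; split=> // i j.
by rewrite !mxE; case: splitP => a _; rewrite ?mxE//; exact: ballxx.
Qed.

Lemma Cb_row1 (g : E -> R) : Cb g -> Cb (fun x : 'rV[E]_1 => g (x ord0 ord0)).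
Proof.
move=> Cg; apply: (Cb_comp (F := fun x : 'rV[E]_1 => x ord0 ord0) _ Cg).
by apply: nonexpansive_continuous => x y e e0 [_]; exact.
Qed.

End coordinate_rows.

Section last_coordinate.
Context {R : realType} {E : metricType R} {k : path_kind}.
Local Notation Omega := (pathT E k).
Hypothesis E_polish : separable_complete E.
Implicit Types (tau : nat -> R) (v w : Omega).

Definition path_row tau m v : 'rV[E]_m := \row_i v (tau i).

Lemma path_rowD1 tau m v :
  path_row tau (m + 1) v = row_mx (path_row tau m v) (const_mx (v (tau m))).
Proof.
apply/rowP => i; rewrite !mxE; case: splitP => j ij; rewrite !mxE ij//.
by rewrite ord1 addn0.
Qed.

Lemma path_row_measurable tau m t (f : 'rV[E]_m -> R) : Cb f ->
  (forall i, (i < m)%N -> tau i <= t) ->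
  bounded_measurable (sFt E k t) (fun v => f (path_row tau m v)).
Proof.
move=> Cf taut.
apply: (@measurable_cylinder _ _ _ _ _ (fun i => tau (nat_of_ord i))) => //.
  exact: sFt_salg.
by move=> i B bB; apply: coord_sFt => //; exact: taut.
Qed.

Lemma path_row_measurableF tau m (f : 'rV[E]_m -> R) : Cb f ->
  bounded_measurable (sF E k) (fun v => f (path_row tau m v)).
Proof.
move=> Cf; apply: (@measurable_cylinder _ _ _ _ _ (fun i => tau (nat_of_ord i))) => //.
  exact: sF_salg.
by move=> i B bB; exact: coord_sF.
Qed.

Lemma measurable_coordinate s (g : E -> R) : Cb g ->
  bounded_measurable (sF E k) (fun v => g (v s)).
Proof.
move=> Cg; have := path_row_measurableF (fun=> s) (Cb_row1 Cg).
by rewrite (_ : (fun v => _) = (fun v => g (v s)))//; apply/funext => v; rewrite mxE.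
Qed.

(** The past coordinates are frozen at their values on [w], and the law of the
    remaining one is given by the semigroup. *)
Lemma cexp_last_coordinate calE tau m t w (f : 'rV[E]_(m + 1) -> R) :
  convex_expectation calE -> homogeneous calE -> markovian calE -> Cb f ->
  (forall i, (i < m)%N -> tau i <= t) -> t < tau m ->
  calE t (fun v => f (path_row tau (m + 1) v)) w =
  markov_semigroup calE (tau m - t)
    (fun y => f (row_mx (path_row tau m w) (const_mx y))) (w t).
Proof.
move=> cexpE homE markovE Cf taut ttau.
pose g (y : E) : R := f (row_mx (path_row tau m w) (const_mx y)).
have Cg : Cb g by exact: (Cb_comp (@continuous_row_mxr _ _ _ _) Cf).
have mg := measurable_coordinate (tau m) Cg.
have mf := path_row_measurableF tau Cf.
pose N i := if (i < m)%N then [set v : Omega | v (tau i) <> w (tau i)] else set0.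
have negN : cexp_null calE t w (\bigcup_i N i).
  apply: cexp_null_bigcup => // i; rewrite /N; case: ifP => im.
    by apply: cexp_null_past => //; exact: taut.
  exact: cexp_null0.
have frozen v : ~ (\bigcup_i N i) v -> f (path_row tau (m + 1) v) = g (v (tau m)).
  move=> Nv; rewrite path_rowD1 /g; congr (f (row_mx _ _)).
  apply/rowP => i; rewrite !mxE; apply: contrapT => vw; apply: Nv.
  by exists (nat_of_ord i) => //; rewrite /N ltn_ord.
have -> : calE t (fun v => f (path_row tau (m + 1) v)) w =
    calE t (fun v => g (v (tau m))) w.
  by apply/eqP; rewrite eq_le; apply/andP; split;
    apply: (cexp_null_le cexpE negN) => // v /frozen ->.
rewrite homE; last exact: bounded_measurable_USAb.
have := markov_semigroupE markovE (t := tau m - t) _ Cg (path_shift t w).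
by rewrite /= add0r subr_gt0 => ->.
Qed.

Lemma cexp_cst calE t (c : R) w : convex_expectation calE -> calE t (fun=> c) w = c.
Proof.
move=> cexpE; rewrite (cexp_id cexpE)//.
apply: USAb_cst; [exact: (salgT (sFt_salg t))|exact: (salg0 (sFt_salg t))].
Qed.

End last_coordinate.

Section cylinder_comparison.
Context {R : realType} {E : metricType R} {k : path_kind}.
Local Notation Omega := (pathT E k).
Variables calE calE' : R -> (Omega -> R) -> Omega -> R.
Hypothesis E_polish : separable_complete E.
Hypothesis calE_cexp : convex_expectation calE.
Hypothesis calE'_cexp : convex_expectation calE'.
Hypothesis calE_hom : homogeneous calE.
Hypothesis calE'_hom : homogeneous calE'.
Hypothesis calE_markov : markovian calE.
Hypothesis calE'_markov : markovian calE'.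
Hypothesis calE'_cont : continuity_preserving calE'.
Hypothesis semigroup_le : forall t : R, 0 < t -> forall g : E -> R, Cb g ->
  forall x : E, markov_semigroup calE t g x <= markov_semigroup calE' t g x.

Let path_row_comparison (m : nat) : Prop :=
  forall (tau : nat -> R) (f : 'rV[E]_m -> R),
  (forall i j, (i < j < m)%N -> tau i < tau j) -> Cb f ->
  forall t w, calE t (fun v => f (path_row tau m v)) w <=
              calE' t (fun v => f (path_row tau m v)) w.

(** Induction on the number of times. If the last two times lie after [t], the
    expectation is first conditioned at the last but one; continuity
    preservation makes the resulting function of the earlier coordinates a
    continuous one, to which the induction hypothesis applies. *)
Lemma path_row_le m : path_row_comparison m.
Proof.
elim: m => [|m IH].
  move=> tau f _ Cf t w.
  have -> : (fun v : Omega => f (path_row tau 0 v)) =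
      fun=> f (path_row tau 0 w).
    by apply/funext => v; congr f; apply/rowP => -[].
  by rewrite !cexp_cst.
rewrite -(addn1 m) => tau f tau_incr Cf t w.
have [st|ts] := leP (tau m) t.
  have Ff : USAb (sFt E k t) (fun v : Omega => f (path_row tau (m + 1) v)).
    apply: bounded_measurable_USAb; apply: path_row_measurable => // i.
    rewrite addn1 ltnS leq_eqVlt => /orP[/eqP->//|im].
    by rewrite (le_trans _ st)// ltW// tau_incr// im addn1 ltnSn.
  by rewrite (cexp_id calE_cexp)// (cexp_id calE'_cexp).
have semi_le p x v : p < tau m ->
    markov_semigroup calE (tau m - p) (fun y => f (row_mx x (const_mx y))) v <=
    markov_semigroup calE' (tau m - p) (fun y => f (row_mx x (const_mx y))) v.
  move=> pm; apply: semigroup_le; first by rewrite subr_gt0.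
  exact: (Cb_comp (@continuous_row_mxr _ _ _ _) Cf).
have [taut|] := pselect (forall i, (i < m)%N -> tau i <= t).
  by rewrite !cexp_last_coordinate//; exact: semi_le.
case: m => [|m] in IH f tau_incr Cf ts semi_le *; first by move=> h; exfalso; apply: h.
move=> past; pose p := tau m.
have tp : t < p.
  rewrite ltNge; apply/negP => pt; apply: past => i; rewrite ltnS leq_eqVlt.
  move=> /orP[/eqP->//|im].
  by apply: le_trans pt; apply/ltW/tau_incr; rewrite im addn1 ltnS leqW.
have ps : p < tau m.+1 by apply: tau_incr; rewrite ltnSn addn1 ltnSn.
have past_p i : (i < m.+1)%N -> tau i <= p.
  rewrite ltnS leq_eqVlt => /orP[/eqP->//|im].
  by apply/ltW/tau_incr; rewrite im addn1 ltnS leqW.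
set phi := fun v : Omega => f (path_row tau (m.+1 + 1) v).
have Fphi : USAb (sF E k) phi.
  by apply: bounded_measurable_USAb; exact: path_row_measurableF.
pose fhat (x : 'rV[E]_m.+1) := markov_semigroup calE' (tau m.+1 - p)
  (fun y => f (row_mx x (const_mx y))) (x ord0 ord_max).
have Cfhat : Cb fhat by apply: calE'_cont => //; rewrite subr_gt0.
have calE'_phi : calE' p phi = fun v => fhat (path_row tau m.+1 v).
  apply/funext => v; rewrite cexp_last_coordinate// /fhat.
  by rewrite [in RHS]mxE.
rewrite -(cexp_tower calE_cexp tp Fphi) -(cexp_tower calE'_cexp tp Fphi).
apply: (@le_trans _ _ (calE t (calE' p phi) w)).
  have usaE (calF : R -> (Omega -> R) -> Omega -> R) :
      convex_expectation calF -> USAb (sF E k) (calF p phi).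
    move=> cexpF; have [bF aF] := cexp_adapted cexpF p Fphi.
    by split=> // c; apply: analyticS (aF c); exact: sFt_sub.
  apply: (cexp_mono calE_cexp); [exact: usaE|exact: usaE|move=> v].
  by rewrite !cexp_last_coordinate//; exact: semi_le.
by rewrite calE'_phi; apply: IH => // i j /andP[ij jm];
  apply: tau_incr; rewrite ij addn1 leqW.
Qed.

(** Arbitrary times are brought to increasing order without repetition. *)
Lemma cylinder_le n (tau : 'I_n -> R) (f : 'rV[E]_n -> R) t w : Cb f ->
  calE t (fun v : Omega => f (\row_i v (tau i))) w <=
  calE' t (fun v : Omega => f (\row_i v (tau i))) w.
Proof.
move=> Cf; pose ts := sort <=%R (undup (codom tau)).
have tau_ts i : tau i \in ts by rewrite mem_sort mem_undup codom_f.
pose h i : 'I_(size ts) := Ordinal (eq_ind _ is_true (tau_ts i) _ (esym (index_mem _ _))).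
have := @path_row_le (size ts) (nth 0 ts)
  (fun x => f (\row_i x ord0 (h i))) _ (Cb_comp (@continuous_reindex _ _ _ _ h) Cf) t w.
rewrite (_ : (fun v : Omega => _) = fun v : Omega => f (\row_i v (tau i))).
  apply=> i j /andP[ij js].
  have ts_sorted : sorted <%R ts by rewrite sort_lt_sorted undup_uniq.
  by apply: (sorted_ltn_nth lt_trans) => //; rewrite inE ?(ltn_trans ij).
apply/funext => v; congr f; apply/rowP => i; rewrite !mxE /=.
by rewrite nth_index.
Qed.

End cylinder_comparison.

(** * Continuous majorants of cylinder functions *)

Section sup_convolution.
Context {R : realType} {E : metricType R} {k : path_kind}.
Local Notation Omega := (pathT E k).
Implicit Types (v w : Omega) (r s : R).

(** For continuous paths the identity serves as the time change, so both path
    spaces are treated alike from here on. *)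
Lemma path_nbhs_time_change w v (N e : R) : 0 < e -> path_nbhs w N e v ->
  exists lam, time_change lam /\ forall r, `|r| <= N ->
    `|lam r - r| < e /\ mdist (w r) (v (lam r)) < e.
Proof.
move=> e0; case: k w v => w v /=.
  move=> [lam [tl h]]; exists lam; split=> // r /h.
  by rewrite ballEmdist.
move=> h; exists id; split; last first.
  by move=> r /h; rewrite ballEmdist subrr normr0.
by split=> //; exists id.
Qed.

Variables (g : E -> R) (s : R).
Hypothesis g01 : forall x, 0 <= g x <= 1.
Hypothesis g_lip : forall x y, g x <= g y + mdist x y.

Lemma lipschitz_Cb : Cb g.
Proof.
split; first by apply: bounded_realP; exists 0, 1.
move=> x; apply/cvgrPdist_lt => e e0; near=> y.
have xy : ball x e y by near: y; exact: nbhsx_ballx.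
rewrite ballEmdist /= in xy.
have h1 := g_lip x y; have h2 := g_lip y x; rewrite metric_sym in h2.
by rewrite ltr_norml; apply/andP; split; lra.
Unshelve. all: by end_near. Qed.

Let penalized (n : nat) v r : R := g (v r) - n.+1%:R * `|r - s|.

(** Evaluation at a fixed time is not J1-continuous; the supremum over nearby
    times, penalized by the distance to [s], is. *)
Definition sup_convolution n v : R := sup (range (penalized n v)).

Let penalized_le1 n v r : penalized n v r <= 1.
Proof.
have /andP[_ g1] := g01 (v r); rewrite lerBlDr (le_trans g1)// lerDl.
exact: mulr_ge0.
Qed.

Let has_sup_penalized n v : has_sup (range (penalized n v)).
Proof.
split; first by exists (penalized n v 0), 0.
by exists 1 => _ [r _ <-].
Qed.

Let sup_convolution_ge n v r : penalized n v r <= sup_convolution n v.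
Proof. by apply: ub_le_sup; [have [] := has_sup_penalized n v|exists r]. Qed.

Let sup_convolution_le n v c : (forall r, penalized n v r <= c) ->
  sup_convolution n v <= c.
Proof.
move=> h; apply: ge_sup; first by have [] := has_sup_penalized n v.
by move=> _ [r _ <-].
Qed.

Lemma sup_convolution_majorant n v : g (v s) <= sup_convolution n v.
Proof.
apply: le_trans (sup_convolution_ge n v s).
by rewrite /penalized subrr normr0 mulr0 subr0.
Qed.

Let sup_convolution_ge0 n v : 0 <= sup_convolution n v.
Proof. by apply: le_trans (sup_convolution_majorant n v); case/andP: (g01 (v s)). Qed.

Lemma sup_convolution_bounded n : bounded_real (sup_convolution n).
Proof.
apply: bounded_realP; exists 0, 1 => v; rewrite sup_convolution_ge0 /=.
exact: sup_convolution_le.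
Qed.

Lemma sup_convolution_nonincreasing v : nonincreasing_seq (sup_convolution ^~ v).
Proof.
apply/nonincreasing_seqP => n; apply: sup_convolution_le => r.
apply: le_trans (sup_convolution_ge n v r).
by rewrite lerD2l lerN2 ler_wpM2r// ler_nat.
Qed.

(** As [g <= 1], the penalty exceeds any gain at times further than
    [1 / (n + 1)] from [s]. *)
Let penalized_far n v r : n.+1%:R^-1 < `|r - s| -> penalized n v r <= 0.
Proof.
move=> rs; have /andP[_ g1] := g01 (v r); rewrite subr_le0 (le_trans g1)//.
by rewrite -ler_pdivrMl ?ltr0n// mulr1 ltW.
Qed.

Let penalized_close n v w (e r r' : R) : `|r' - r| < e -> mdist (w r) (v r') < e ->
  penalized n w r <= penalized n v r' + n.+2%:R * e /\
  penalized n v r' <= penalized n w r + n.+2%:R * e.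
Proof.
move=> rr wv; have h1 := g_lip (w r) (v r').
have h2 := g_lip (v r') (w r); rewrite metric_sym in h2.
have n0 : (0 : R) <= n.+1%:R by [].
have h3 : `|r' - s| <= `|r - s| + e.
  have -> : r' - s = (r - s) + (r' - r) by ring.
  by apply: (le_trans (ler_normD _ _)); rewrite lerD2l ltW.
have h4 : `|r - s| <= `|r' - s| + e.
  have -> : r - s = (r' - s) - (r' - r) by ring.
  by apply: (le_trans (ler_normB _ _)); rewrite lerD2l ltW.
have h5 := ler_wpM2l n0 h3; have h6 := ler_wpM2l n0 h4.
rewrite /penalized -[n.+2]addn1 natrD; move: h1 h2 wv h5 h6.
set a := g (w r); set b := g (v r'); set m := mdist _ _.
set x := `|r - s|; set y := `|r' - s|; set c := n.+1%:R.
by clear; rewrite !mulrDr => *; split; lra.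
Qed.

(** A time change that nearly preserves times and values carries nearly optimal
    times for one path to nearly optimal times for the other. *)
Lemma sup_convolution_near n w (eps : R) : 0 < eps ->
  exists N e, 0 < e /\ forall v, path_nbhs w N e v ->
    `|sup_convolution n w - sup_convolution n v| <= eps.
Proof.
move=> eps0; pose e := Num.min 1 (eps / n.+2%:R).
have e0 : 0 < e by rewrite lt_min ltr01 divr_gt0.
have e_eps : n.+2%:R * e <= eps by rewrite mulrC -ler_pdivlMr// ge_min lexx orbT.
have e1 : e <= 1 by rewrite ge_min lexx.
(* The last summand leaves room for the displacement of the window by the time
   change, which is less than e <= 1. *)
pose N := `|s| + n.+1%:R^-1 + 1; exists N, e; split=> // v.
move=> /(path_nbhs_time_change e0)[lam [[lam_incr [mu _ lamK]] lamP]].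
have close r : `|r| <= N ->
    penalized n w r <= penalized n v (lam r) + eps /\
    penalized n v (lam r) <= penalized n w r + eps.
  move=> /lamP[h1 h2]; have [h3 h4] := penalized_close n h1 h2.
  by split; [apply: le_trans h3 _|apply: le_trans h4 _]; rewrite lerD2l.
have near_s r : `|r - s| <= n.+1%:R^-1 -> `|r| <= N - 1.
  move=> rs; have -> : r = s + (r - s) by ring.
  by apply: (le_trans (ler_normD _ _)); rewrite /N addrK lerD2l.
have N1 : N - 1 <= N by rewrite gerBl.
have wv : sup_convolution n w <= sup_convolution n v + eps.
  apply: sup_convolution_le => r; have [rs|sr] := leP (`|r - s|) n.+1%:R^-1.
    have [h _] := close r (le_trans (near_s r rs) N1).
    by apply: (le_trans h); rewrite lerD2r.
  by rewrite (le_trans (penalized_far w sr))// addr_ge0// ltW.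
have vw : sup_convolution n v <= sup_convolution n w + eps.
  apply: sup_convolution_le => r'; have [rs|sr] := leP (`|r' - s|) n.+1%:R^-1.
    have N0 : 0 <= N by rewrite !addr_ge0.
    have rN : `|mu r'| <= N.
      have /ler_normlP[h1 h2] := near_s _ rs.
      have NN : `|N| <= N by rewrite ger0_norm.
      have NN' : `|- N| <= N by rewrite normrN ger0_norm.
      have [/ltr_normlP[a1 a2] _] := lamP _ NN.
      have [/ltr_normlP[b1 b2] _] := lamP _ NN'.
      rewrite ler_norml; apply/andP; split; rewrite leNgt; apply/negP => /lam_incr;
        rewrite lamK; lra.
    have [_ h] := close _ rN; rewrite lamK in h.
    by apply: (le_trans h); rewrite lerD2r.
  by rewrite (le_trans (penalized_far v sr))// addr_ge0// ltW.
by rewrite ler_norml; apply/andP; split; lra.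
Qed.

Lemma sup_convolution_Cb n : Cb (sup_convolution n).
Proof.
split; first exact: sup_convolution_bounded.
apply/continuousP => U oU.
suff : path_open (sup_convolution n @^-1` U) by [].
move=> w Uw.
have /nbhs_ballP[e /= e0 eU] : nbhs (sup_convolution n w) U.
  by move: oU; rewrite openE; exact.
have e20 : 0 < e / 2 by rewrite divr_gt0.
have [N [d [d0 h]]] := sup_convolution_near n w e20.
exists N, d; split=> // v /h wv; apply: eU; rewrite /ball /=.
by apply: (le_lt_trans wv); rewrite ltr_pdivrMr// ltr_pMr// ltr1n.
Qed.

(** By right continuity of paths, rational times suffice in the supremum. *)
Lemma sup_convolution_measurable n :
  bounded_measurable (sF E k) (sup_convolution n).
Proof.
have sG := @sF_salg R E k; split; first exact: sup_convolution_bounded.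
have Gpen r d : sF E k [set v : Omega | d < penalized n v r].
  rewrite [X in sF E k X](_ : _ =
      [set v : Omega | - g (v r) < - (d + n.+1%:R * `|r - s|)]).
    apply: (@coord_sF R E k r [set x | - g x < - (d + n.+1%:R * `|r - s|)]).
    apply: borel_open; apply: continuous_open_lt => x; apply: cvgN.
    by have [_ cg] := lipschitz_Cb; exact: cg.
  by apply/seteqP; split => v /=; rewrite ltrN2 ltrBrDr.
have Glt d : sF E k [set v | d < sup_convolution n v].
  rewrite [X in sF E k X](_ : _ = \bigcup_(q in [set: rat])
      [set v : Omega | d < penalized n v (ratr q)]).
    by apply: salg_countable_union.
  apply/seteqP; split => v /=; last first.
    by move=> [q _ dq]; exact: lt_le_trans dq (sup_convolution_ge _ _ _).
  move=> dv; have [_ [r _ <-] dr] := sup_gt (proj1 (has_sup_penalized n v)) dv.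
  have : penalized n v r' @[r' --> r^'+] --> penalized n v r.
    apply: cvgB.
      have [vr _] := path_cadlag v r; have [_ cg] := lipschitz_Cb.
      exact: (cvg_comp _ g vr (cg _)).
    apply: cvgM; first exact: cvg_cst.
    apply: cvg_norm; apply: cvgB; last exact: cvg_cst.
    exact/cvg_at_right_filter/cvg_id.
  move=> /cvgr_gt/(_ _ dr) [e /= e0 eP].
  have /rat_in_itvoo[q] : r < r + e by rewrite ltrDl.
  rewrite inE => /andP[rq qr]; exists q => //; apply: eP => //=.
  by rewrite distrC gtr0_norm ?subr_gt0// ltrBlDl.
move=> c; rewrite [X in sF E k X](_ : _ =
    \bigcap_m [set v | c - m.+1%:R^-1 < sup_convolution n v]).
  exact: salg_bigcap.
apply/seteqP; split => v /= cv.
  by move=> m _ /=; apply: lt_le_trans cv; rewrite gtrBl invr_gt0.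
apply/ler_addgt0Pr => e e0; rewrite -lerBlDr.
have /filter_ex[m me] := near_infty_natSinv_lt (PosNum e0).
by have := cv m I => /= /ltW; apply: le_trans; rewrite lerD2l lerN2 ltW.
Qed.

(** Without a jump at [s] the path is continuous there, and the penalty confines
    the supremum to times within [1 / (n + 1)] of [s]. *)
Lemma sup_convolution_cvg v : ~ jump_at E k s v ->
  sup_convolution n v @[n --> \oo] --> g (v s).
Proof.
move=> nojump; have [vr [l vl]] := path_cadlag v s.
have sl : v s = l by apply: contrapT => vsl; apply: nojump; exists l.
rewrite -sl in vl.
apply/cvgrPdist_le => e e0.
have [d d0 dP] : exists2 d, 0 < d & forall r, `|r - s| < d -> g (v r) <= g (v s) + e.
  move: vr vl => /cvg_ballP/(_ e e0)[d1 /= d10 h1] /cvg_ballP/(_ e e0)[d2 /= d20 h2].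
  exists (Num.min d1 d2); first by rewrite lt_min d10.
  move=> r; rewrite lt_min distrC => /andP[r1 r2].
  have [rs|sr|->] := ltgtP r s; last by rewrite lerDl ltW.
    have := h2 r r2 rs; rewrite /= ballEmdist /= metric_sym => h.
    by apply: (le_trans (g_lip _ (v s))); rewrite lerD2l ltW.
  have := h1 r r1 sr; rewrite /= ballEmdist /= metric_sym => h.
  by apply: (le_trans (g_lip _ (v s))); rewrite lerD2l ltW.
near=> n.
have nd : n.+1%:R^-1 < d by near: n; exact: (near_infty_natSinv_lt (PosNum d0)).
rewrite distrC ger0_norm ?subr_ge0 ?sup_convolution_majorant//.
rewrite lerBlDl; apply: sup_convolution_le => r.
have /andP[g0 _] := g01 (v s).
have [rs|sr] := leP (`|r - s|) n.+1%:R^-1; last first.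
  by apply: (le_trans (penalized_far v sr)); rewrite addr_ge0// ltW.
apply: le_trans (dP r (le_lt_trans rs nd)).
by rewrite gerBl mulr_ge0.
Unshelve. all: by end_near. Qed.

End sup_convolution.

(** * The lattice of approximable cylinder functions *)

Section Cb_closure.
Context {R : realType} {T : topologicalType}.
Implicit Types (f g : T -> R).

Lemma Cb_cst (c : R) : Cb (fun _ : T => c).
Proof. split; first by exists `|c|.
by move=> x; exact: cvg_cst. Qed.

Lemma Cb_max f g : Cb f -> Cb g -> Cb (fun x => Num.max (f x) (g x)).
Proof.
move=> [bf cf] [bg cg]; split; first exact: bounded_max.
by move=> x; apply: cvg_max; [exact: cf|exact: cg].
Qed.

Lemma Cb_min f g : Cb f -> Cb g -> Cb (fun x => Num.min (f x) (g x)).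
Proof.
move=> [bf cf] [bg cg]; split; first exact: bounded_min.
by move=> x; apply: cvg_min; [exact: cf|exact: cg].
Qed.

Lemma Cb_affine f (a b : R) : Cb f -> Cb (fun x => b + a * f x).
Proof.
move=> [bf cf]; split; first exact: bounded_affine.
by move=> x; apply: cvgD; [exact: cvg_cst|apply: cvgM; [exact: cvg_cst|exact: cf]].
Qed.

End Cb_closure.

Section distance_to_complement.
Context {R : realType} {E : metricType R}.

Definition unit_lipschitz (g : E -> R) : Prop :=
  (forall x, 0 <= g x <= 1) /\ (forall x y, g x <= g y + mdist x y).

(** The function is the distance to the complement of [U], truncated at 1. *)
Lemma open_lipschitz (U : set E) : open U -> U <> setT ->
  exists g, unit_lipschitz g /\ U = [set x | 0 < g x].
Proof.
move=> oU UT; have [z0 Uz0] : exists z0, ~ U z0.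
  by apply/existsNP => h; apply: UT; apply/seteqP; split.
pose S x := [set Num.min 1 (mdist x z) | z in ~` U].
have S0 x : S x !=set0 by exists (Num.min 1 (mdist x z0)), z0.
have lbS x : lbound (S x) 0.
  by move=> _ [z _ <-]; rewrite le_min ler01 mdist_ge0.
have Sinf x z : ~ U z -> inf (S x) <= Num.min 1 (mdist x z).
  by move=> Uz; apply: ge_inf; [exists 0|exists z].
exists (fun x => inf (S x)); split.
  split=> [x|x y].
    by rewrite lb_le_inf//= (le_trans (Sinf x _ Uz0))// ge_min lexx.
  rewrite -lerBlDr; apply: lb_le_inf => // _ [z Uz <-].
  rewrite lerBlDr (le_trans (Sinf x z Uz))// addrC.
  have := metric_triangle x y z; have := mdist_ge0 x y.
  set a := mdist x y; set b := mdist y z; set c := mdist x z => a0 cab.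
  have [h1|h1] := leP 1 b; first by rewrite ge_min lerDr a0.
  by rewrite ge_min cab orbT.
apply/seteqP; split => x /=.
  move=> Ux; have /nbhs_ballP[e /= e0 eU] : nbhs x U.
    by move: oU; rewrite openE; exact.
  apply: (@lt_le_trans _ _ (Num.min 1 e)); first by rewrite lt_min ltr01.
  apply: lb_le_inf => // _ [z Uz <-]; rewrite le_min ge_min lexx /= ge_min.
  apply/orP; right; rewrite leNgt; apply/negP => xz; apply: Uz; apply: eU.
  by rewrite ballEmdist.
apply: contraPP => Ux; apply/negP; rewrite -leNgt.
by rewrite (le_trans (Sinf x x Ux))// mdistxx ge_min lexx orbT.
Qed.

End distance_to_complement.

Section approximable.
Context {R : realType} {E : metricType R} {k : path_kind}.
Local Notation Omega := (pathT E k).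
Hypothesis E_polish : separable_complete E.
Variable calE : R -> (Omega -> R) -> Omega -> R.
Hypothesis calE_cexp : convex_expectation calE.
Hypothesis calE_nofix : no_fixed_discontinuity calE.
Variables (t : R) (w : Omega).

Let bmeas (f : Omega -> R) := bounded_measurable (sF E k) f.
Let null := cexp_null calE t w.
Let sG := @sF_salg R E k.

(** Outside a null set, [f] is the decreasing limit of continuous functions.
    The null set is unavoidable: coordinates are not upper semicontinuous for
    the J1 topology. *)
Definition usc_outside_null (f : Omega -> R) : Prop :=
  exists (u : nat -> Omega -> R) (N : set Omega),
  [/\ null N, forall n, Cb (u n) /\ bmeas (u n),
      forall v, nonincreasing_seq (u ^~ v) &
      forall v, ~ N v -> u n v @[n --> \oo] --> f v].

Definition cylinder (f : Omega -> R) : Prop :=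
  exists n (tau : 'I_n -> R) (h : 'rV[E]_n -> R),
    Cb h /\ f = fun v => h (\row_i v (tau i)).

Definition approximable_cylinder : set (Omega -> R) :=
  [set f | cylinder f /\ usc_outside_null f].

Lemma cylinder_measurable f : cylinder f -> bmeas f.
Proof.
move=> [n [tau [h [Ch ->]]]]; apply: measurable_cylinder => //.
by move=> i B bB; exact: coord_sF.
Qed.

Lemma cylinder_cst (c : R) : cylinder (fun=> c).
Proof. by exists 0%N, (fun=> 0), (fun=> c); split=> //; exact: Cb_cst. Qed.

Lemma cylinder2 (op : R -> R -> R) f g :
  (forall (T : topologicalType) (p q : T -> R), Cb p -> Cb q ->
    Cb (fun x => op (p x) (q x))) ->
  cylinder f -> cylinder g -> cylinder (fun v => op (f v) (g v)).
Proof.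
move=> Cop [n [tau [h [Ch ->]]]] [n' [tau' [h' [Ch' ->]]]].
pose sigma (i : 'I_(n + n')) :=
  match fintype.split i with inl j => tau j | inr j => tau' j end.
exists (n + n')%N, sigma, (fun x => op (h (\row_i x ord0 (lshift n' i)))
  (h' (\row_i x ord0 (rshift n i)))); split.
  by apply: Cop; [exact: (Cb_comp (@continuous_reindex _ _ _ _ _) Ch)|
                  exact: (Cb_comp (@continuous_reindex _ _ _ _ _) Ch')].
apply/funext => v; congr (op (h _) (h' _)); apply/rowP => i; rewrite !mxE /sigma.
  by case: splitP => j /= ij; [congr (v (tau _)); exact: val_inj|
    have := ltn_ord i; rewrite ij ltnNge leq_addr].
case: splitP => j /= ij; last by congr (v (tau' _)); apply: val_inj; apply: (addnI ij).
by have := ltn_ord j; rewrite -ij ltnNge leq_addr.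
Qed.

Lemma usc_outside_null2 (op : R -> R -> R) f g :
  (forall p q, Cb p /\ bmeas p -> Cb q /\ bmeas q ->
    Cb (fun v => op (p v) (q v)) /\ bmeas (fun v => op (p v) (q v))) ->
  (forall a b a' b', a <= a' -> b <= b' -> op a b <= op a' b') ->
  (forall (u v : nat -> R) (a b : R), u @ \oo --> a -> v @ \oo --> b ->
    op (u n) (v n) @[n --> \oo] --> op a b) ->
  usc_outside_null f -> usc_outside_null g ->
  usc_outside_null (fun v => op (f v) (g v)).
Proof.
move=> Cop op_mono op_cvg [u [N [N0 Cu du cu]]] [u' [N' [N'0 Cu' du' cu']]].
exists (fun n v => op (u n v) (u' n v)), (N `|` N'); split.
- exact: cexp_nullU.
- by move=> n; exact: Cop.
- by move=> v n m nm; apply: op_mono; [exact: du|exact: du'].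
- by move=> v /not_orP[Nv N'v]; apply: op_cvg; [exact: cu|exact: cu'].
Qed.

Lemma approximable_cone_lattice : is_cone_lattice approximable_cylinder.
Proof.
split.
- move=> c; split; first exact: cylinder_cst.
  exists (fun _ _ => c), set0; split.
  + exact: cexp_null0.
  + by move=> _; split; [exact: Cb_cst|exact: bounded_measurable_cst].
  + by move=> v n m _.
  + by move=> v _; exact: cvg_cst.
- move=> f g [cf uf] [cg ug]; split.
    by apply: cylinder2 => // T p q; exact: Cb_max.
  apply: usc_outside_null2 => //.
  + move=> p q [Cp mp] [Cq mq]; split; first exact: Cb_max.
    exact: bounded_measurable_max.
  + by move=> a b a' b' aa bb; rewrite ge_max !le_max aa bb orbT.
  + by move=> *; exact: cvg_max.
- move=> f g [cf uf] [cg ug]; split.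
    by apply: cylinder2 => // T p q; exact: Cb_min.
  apply: usc_outside_null2 => //.
  + move=> p q [Cp mp] [Cq mq]; split; first exact: Cb_min.
    exact: bounded_measurable_min.
  + by move=> a b a' b' aa bb; rewrite le_min !ge_min aa bb orbT.
  + by move=> *; exact: cvg_min.
- move=> f a b [cf uf] a0; split.
    apply: (cylinder2 (op := fun x _ => b + a * x) _ cf cf).
    by move=> T p q Cp _; exact: Cb_affine.
  apply: (usc_outside_null2 (op := fun x _ => b + a * x) _ _ _ uf uf).
  + move=> p _ [Cp mp] _; split; first exact: Cb_affine.
    exact: bounded_measurable_affine.
  + by move=> x _ x' _ xx _; rewrite lerD2l ler_wpM2l.
  + move=> u _ x _ ux _; apply: cvgD; first exact: cvg_cst.
    by apply: cvgM => //; exact: cvg_cst.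
Qed.

(** Coordinates at past times are constant outside a null set; at future times
    the sup-convolutions converge outside the paths that jump. *)
Lemma coordinate_approximable s g : unit_lipschitz g ->
  approximable_cylinder (fun v => g (v s)).
Proof.
move=> [g01 g_lip]; have Cg := lipschitz_Cb g01 g_lip; split.
  exists 1%N, (fun=> s), (fun x => g (x ord0 ord0)); split; first exact: Cb_row1.
  by apply/funext => v; rewrite mxE.
have [st|ts] := leP s t.
  exists (fun _ _ => g (w s)), [set v | v s <> w s]; split.
  - exact: cexp_null_past.
  - by move=> _; split; [exact: Cb_cst|exact: bounded_measurable_cst].
  - by move=> v n m _.
  - by move=> v /contrapT ->; exact: cvg_cst.
exists (sup_convolution g s), (jump_at E k s); split.
- exact: cexp_null_jump.
- by move=> n; split; [exact: sup_convolution_Cb|exact: sup_convolution_measurable].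
- by move=> v; exact: sup_convolution_nonincreasing.
- by move=> v; exact: sup_convolution_cvg.
Qed.

(** Continuity from above, known for continuous functions, extends to
    decreasing sequences of approximable cylinder functions: a diagonal minimum
    of their continuous approximants decreases to the same limit outside a null
    set. *)
Lemma approximable_decreasing (u : nat -> Omega -> R) f :
  (forall n, approximable_cylinder (u n)) -> USAb (sF E k) f ->
  decreases_to u f ->
  forall r, (forall n, r <= calE t (u n) w) -> r <= calE t f w.
Proof.
move=> Lu [/bounded_real_itv[M M0 fM] _] [u_dec u_f] r ru.
have mu n : bmeas (u n) by have [/cylinder_measurable] := Lu n.
have uf n v : f v <= u n v.
  rewrite -(cvg_lim _ (u_f v))//; apply: nonincreasing_cvgn_ge => //.
  by apply/cvg_ex; exists (f v).
have mf : bmeas f.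
  apply: (bounded_measurable_decreasing_limit sG mu) => //.
  by apply: bounded_realP; exists (- M), M.
have /choice[a aP] : forall n, exists a : nat -> Omega -> R, exists N,
  [/\ null N, forall j, Cb (a j) /\ bmeas (a j),
      forall v, nonincreasing_seq (a ^~ v) &
      forall v, ~ N v -> a j v @[j --> \oo] --> u n v].
  by move=> n; have [_] := Lu n.
have {aP} /choice[N aP] := aP.
have a_dec n v : nonincreasing_seq (a n ^~ v) by have [] := aP n.
have a_cvg n v : ~ N n v -> a n j v @[j --> \oo] --> u n v.
  by have [_ _ _] := aP n; exact.
pose Nf := \bigcup_n N n.
have Nf0 : null Nf by apply: cexp_null_bigcup => // n; have [] := aP n.
have a_ge n j v : ~ Nf v -> u n v <= a n j v.
  move=> Nv; have av := a_cvg n v (fun h => Nv (ex_intro2 _ _ n I h)).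
  rewrite -(cvg_lim _ av)//; apply: nonincreasing_cvgn_ge => //.
  by apply/cvg_ex; exists (u n v).
pose fix mina (j n : nat) (v : Omega) {struct j} : R :=
  if j is i.+1 then Num.min (mina i n v) (a j n v) else a 0%N n v.
(* Truncation at the lower bound of f keeps the limit of chi bounded also on the
   null set. *)
pose chi n v := Num.max (- M) (mina n n v).
have mina_Cb j n : Cb (mina j n) /\ bmeas (mina j n).
  elim: j => [|j [IH1 IH2]]; first by have [_ + _ _] := aP 0%N; exact.
  have [_ /(_ n)[h1 h2] _ _] := aP j.+1.
  by split; [exact: Cb_min|exact: bounded_measurable_min].
have chi_Cb n : Cb (chi n) /\ bmeas (chi n).
  have [h1 h2] := mina_Cb n n; split; first by apply: Cb_max => //; exact: Cb_cst.
  by apply: bounded_measurable_max => //; exact: bounded_measurable_cst.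
have mina_le j n i v : (i <= j)%N -> mina j n v <= a i n v.
  elim: j => [|j IH]; first by rewrite leqn0 => /eqP->.
  rewrite leq_eqVlt => /orP[/eqP->|ij] /=; first by rewrite ge_min lexx orbT.
  by rewrite ge_min IH.
have mina_dec j n v : mina j n.+1 v <= mina j n v.
  elim: j => [|j IH] /=; first exact: a_dec.
  by rewrite le_min !ge_min IH /= a_dec ?orbT.
have chi_dec v : nonincreasing_seq (chi ^~ v).
  apply/nonincreasing_seqP => n; rewrite /chi ge_max !le_max lexx /=.
  by apply/orP; right; rewrite ge_min mina_dec.
have chi_ge n v : ~ Nf v -> u n v <= chi n v.
  move=> Nv; rewrite /chi le_max; apply/orP; right.
  have : forall j, (j <= n)%N -> u n v <= mina j n v.
    elim=> [|j IH] jn /=; first by rewrite (le_trans _ (a_ge _ _ _ Nv))// u_dec.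
    by rewrite le_min IH ?(ltnW jn)//= (le_trans _ (a_ge _ _ _ Nv))// u_dec.
  exact.
have chi_geM n v : - M <= chi n v by rewrite /chi le_max lexx.
have chi_cvg v : cvgn (chi ^~ v).
  apply: nonincreasing_is_cvgn => //.
  by exists (- M) => _ [n _ <-]; exact: chi_geM.
pose chi_inf v := lim (chi n v @[n --> \oo]).
have chi_inf_decr : decreases_to chi chi_inf by split.
have m_chi_inf : bmeas chi_inf.
  apply: (bounded_measurable_decreasing_limit sG (fun n => proj2 (chi_Cb n))) => //.
  have [_ [/bounded_real_itv[K K0 chiK] _]] := chi_Cb 0%N.
  apply: bounded_realP; exists (- M), K => v; apply/andP; split.
    by apply: limr_ge => //; exact: nearW.
  apply: (@le_trans _ _ (chi 0%N v)); last by have /andP[] := chiK v.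
  exact: nonincreasing_cvgn_ge.
have chi_inf_le v : ~ Nf v -> chi_inf v <= f v.
  move=> Nv; rewrite -(cvg_lim _ (u_f v))//; apply: limr_ge.
    by apply/cvg_ex; exists (f v).
  apply: nearW => i.
  rewrite -(cvg_lim _ (a_cvg i v (fun h => Nv (ex_intro2 _ _ i I h))))//.
  apply: limr_ge.
    by apply/cvg_ex; exists (u i v); apply: a_cvg => h; apply: Nv; exists i.
  apply: nearW => j; apply: (@le_trans _ _ (chi (maxn i j) v)).
    exact: nonincreasing_cvgn_ge.
  rewrite /chi ge_max; apply/andP; split.
    have /andP[fv _] := fM v; apply: (le_trans fv); apply: (le_trans (uf i v)).
    exact: a_ge.
  apply: (le_trans (mina_le _ _ i v _)); first exact: leq_maxl.
  by apply: a_dec; exact: leq_maxr.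
apply: (@le_trans _ _ (calE t chi_inf w)); last exact: (cexp_null_le calE_cexp Nf0).
have [_ /(_ w) h] := cexp_decr calE_cexp t (fun n => proj1 (chi_Cb n))
  (bounded_measurable_USAb m_chi_inf) chi_inf_decr.
rewrite -(cvg_lim _ h)//; apply: limr_ge; first by apply/cvg_ex; eexists; exact: h.
apply: nearW => n; apply: (le_trans (ru n)).
exact: (cexp_null_le calE_cexp Nf0 (mu n) (proj2 (chi_Cb n)) (chi_ge n)).
Qed.

(** Coordinate events are Souslin over levels of approximable cylinder
    functions because open sets are positivity sets of Lipschitz functions. *)
Lemma sF_sub_analytic :
  sF E k `<=` analytic_set (levels approximable_cylinder).
Proof.
have Lcl := approximable_cone_lattice.
apply: sigma_sub_analytic; [exact: levelsT|exact: levels0|].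
move=> _ [s [B [bB ->]]]; have LT := levelsT Lcl.
pose P := levels approximable_cylinder.
apply: (bB [set B | analytic_set P [set v : Omega | B (v s)] /\
                    analytic_set P (~` [set v : Omega | B (v s)])]).
split.
  split.
  - by split; apply: sub_analytic; [exact: levels0|rewrite setC0].
  - move=> A [anA anCA]; rewrite setTD; split=> //.
    by rewrite (_ : ~` _ = [set v : Omega | A (v s)])//; exact: setCK.
  - move=> F FP; split.
      by apply: (analytic_bigcup (A := fun n => [set v : Omega | F n (v s)])) => // n;
        have [] := FP n.
    rewrite setC_bigcup.
    by apply: (analytic_bigcap (A := fun n => ~` [set v : Omega | F n (v s)])) => // n;
      have [] := FP n.
move=> U oU; have [->|UT] := pselect (U = setT).
  split; first exact: sub_analytic.
  by apply: sub_analytic; rewrite setCT; exact: levels0.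
have [g [gl Ug]] := open_lipschitz oU UT.
have Lg := coordinate_approximable s gl.
split.
  rewrite [X in analytic_set P X](_ : _ = \bigcup_n
      [set v : Omega | 1 <= (1 - n.+1%:R^-1) + 1 * g (v s)]).
    apply: analytic_bigcup => // n; apply: sub_analytic.
    exists (fun v => (1 - n.+1%:R^-1) + 1 * g (v s)) => //.
    by apply: (cl_aff Lcl); rewrite ?ler01.
  apply/seteqP; split => v; rewrite Ug /=.
    move=> gv; have /filter_ex[n /= nv] := near_infty_natSinv_lt (PosNum gv).
    by exists n => //=; rewrite mul1r -addrA lerDl addrC subr_ge0 ltW.
  move=> [n _ /=]; rewrite mul1r -addrA lerDl addrC subr_ge0; apply: lt_le_trans.
  by rewrite invr_gt0.
have [g01 g_lip] := gl.
have L1g : approximable_cylinder (fun v => 1 - g (v s)).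
  apply: (@coordinate_approximable s (fun x => 1 - g x)); split.
    by move=> x; have /andP[g0 g1] := g01 x; rewrite subr_ge0 g1 gerBl.
  by move=> x y; have := g_lip y x; rewrite metric_sym; lra.
apply: sub_analytic; exists (fun v => 1 - g (v s)) => //.
apply/seteqP; split => v; rewrite Ug /= lerBrDl gerDr.
  by move=> /negP; rewrite -leNgt.
by move=> gv; apply/negP; rewrite -leNgt.
Qed.

End approximable.

Theorem theorem4p4 (R : realType) (E : metricType R)
  (E_polish : separable_complete E) (k : path_kind)
  (calE calE' : R -> (pathT E k -> R) -> pathT E k -> R)
  (calE_cexp : convex_expectation calE)
  (calE'_cexp : convex_expectation calE')
  (calE_hom : homogeneous calE) (calE'_hom : homogeneous calE')
  (calE_markov : markovian calE) (calE'_markov : markovian calE')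
  (calE_nofix : no_fixed_discontinuity calE)
  (calE'_nofix : no_fixed_discontinuity calE')
  (calE'_cont : continuity_preserving calE') :
  (forall t : R, 0 < t -> forall g : E -> R, Cb g -> forall x : E,
     markov_semigroup calE t g x <= markov_semigroup calE' t g x)
  <->
  (forall phi : pathT E k -> R, USAb (sF E k) phi ->
     forall (t : R) (w : pathT E k), calE t phi w <= calE' t phi w).
Proof.
split=> [semigroup_le phi Uphi t w|expectation_le t t0 g Cg x]; last first.
  apply: expectation_le; apply: bounded_measurable_USAb.
  exact: measurable_coordinate.
have sG := @sF_salg R E k.
pose L := approximable_cylinder calE' t w.
have L_cyl f : L f -> cylinder f by case.
apply: (@choquet_comparison R (pathT E k) (sF E k) L
  (fun f => calE t f w) (fun f => calE' t f w)) => //.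
- exact: (salgT sG).
- exact: (salg0 sG).
- exact: approximable_cone_lattice.
- move=> f /L_cyl fcyl; apply: bounded_measurable_USAb.
  exact: cylinder_measurable.
- by move=> f g Uf Ug fg; exact: (cexp_mono calE_cexp).
- by move=> f g Uf Ug fg; exact: (cexp_mono calE'_cexp).
- move=> u f Uu Uf uf r rf.
  have [_ /(_ w) cvg_u] := cexp_incr calE_cexp t Uu Uf uf.
  by have := cvgr_gt _ cvg_u _ rf => /(_ _)/filter_ex; exact.
- exact: approximable_decreasing.
- by move=> f [[n [tau [h [Ch ->]]]] _]; exact: (cylinder_le E_polish calE_cexp calE'_cexp
    calE_hom calE'_hom calE_markov calE'_markov calE'_cont semigroup_le).
- exact: sF_sub_analytic.
Qed.
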